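(* Let $p$ be an odd prime, $n$ a positive integer and $G=ES_2(p,n)$. Write elements of $M_{2n}(\mathbb{F}_p)$ in $n\times n$ blocks as $\overline{\sigma}=\begin{pmatrix}A&C\\ D&B\end{pmatrix}$ with $A=[a_{ij}]$, $B=[b_{ij}]$, $C=[c_{ij}]$, $D=[d_{ij}]\in M_n(\mathbb{F}_p)$. Then: (1) $\mathrm{Im}(\Phi_2)=\mathrm{Im}\big(Aut(G)\to Aut(G/\mathcal{Z}(G))\big)$ is the set of all $\overline{\sigma}=\begin{pmatrix}A&C\\ D&B\end{pmatrix}\in Sp^{scalar}(2n,\mathbb{F}_p)$ with $a_{11}\neq0$, $b_{11}=1$, $a_{12}=\cdots=a_{1n}=0$, $c_{11}=c_{12}=\cdots=c_{1n}=0$, $c_{21}=c_{31}=\cdots=c_{n1}=0$, $b_{21}=b_{31}=\cdots=b_{n1}=0$ and $\overline{\sigma}^t\Delta\overline{\sigma}=a_{11}\Delta$. (2) $\mathrm{Im}\big(End(G)\to End(G/\mathcal{Z}(G))\big)$ is the disjoint union of $\mathrm{Im}(\Phi_2)$ and the set of all $\overline{\sigma}=\begin{pmatrix}A&C\\ D&B\end{pmatrix}\in symp^{scalar}(2n,\mathbb{F}_p)$ with $a_{11}=a_{12}=\cdots=a_{1n}=0$, $c_{11}=c_{12}=\cdots=c_{1n}=0$ and $\overline{\sigma}^t\Delta\overline{\sigma}=0_{2n\times2n}$. (3) $\sigma\in Aut(G)$ is an inner automorphism if and only if $\overline{\sigma}=\mathrm{Id}_{2n\times2n}$. In this case, for any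 $(u_1,\underline{u},w_1,\underline{w})\in G$, with $\widetilde{\underline{w}}=\begin{pmatrix}w_1\\\underline{w}\end{pmatrix}$, one has $\sigma(u_1,\underline{u},w_1,\underline{w})=\big(au_1+i_{21}(\alpha(\underline{u})+\beta(\widetilde{\underline{w}})),\underline{u},w_1,\underline{w}\big)$ for some $\alpha\in((\mathbb{Z}/p\mathbb{Z})^{n-1})^{\vee}$, $\beta\in((\mathbb{Z}/p\mathbb{Z})^n)^{\vee}$ and $a\in(\mathbb{Z}/p^2\mathbb{Z})^{*}$ with $a\equiv1\bmod p$ (depending only on $\sigma$). (4) There is an exact sequence $$1\longrightarrow G/\mathcal{Z}(G)\cong Inn(G)\hookrightarrow Aut(G)\longrightarrow\mathrm{Im}(\Phi_2)\longrightarrow1.$$ (5) $|\mathrm{Im}(\Phi_2)|=p^{2n-1}(p-1)\,|Sp(2n-2,\mathbb{F}_p)|$. (6) $|Aut(G)|=p^{2n}|\mathrm{Im}(\Phi_2)|=p^{n^2+2n}(p-1)\prod_{j=1}^{n-1}(p^{2j}-1)$.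
   Context: Let $i_{21}:\mathbb{Z}/p\mathbb{Z}\hookrightarrow\mathbb{Z}/p^2\mathbb{Z}$, $a\mapsto pa$. $ES_2(p,n)$ is the set $\mathbb{Z}/p^2\mathbb{Z}\oplus(\mathbb{Z}/p\mathbb{Z})^{n-1}\oplus\mathbb{Z}/p\mathbb{Z}\oplus(\mathbb{Z}/p\mathbb{Z})^{n-1}$ with group operation $(u^1_1,\underline{u}^1,w^1_1,\underline{w}^1).(u^2_1,\underline{u}^2,w^2_1,\underline{w}^2)=\big(u^1_1+u^2_1+i_{21}(w^2_1)u^1_1+i_{21}(\langle\underline{u}^1,\underline{w}^2\rangle),\underline{u}^1+\underline{u}^2,w^1_1+w^2_1,\underline{w}^1+\underline{w}^2\big)$, where $\langle\underline{u},\underline{w}\rangle=\sum_{i=2}^nu_iw_i\in\mathbb{Z}/p\mathbb{Z}$ for $\underline{u}=(u_2,\ldots,u_n)^t$, $\underline{w}=(w_2,\ldots,w_n)^t$. Its center is $\mathcal{Z}(G)=p(\mathbb{Z}/p^2\mathbb{Z})\oplus\{\underline{0}\}\oplus\{0\}\oplus\{\underline{0}\}$. $G/\mathcal{Z}(G)$ is identified with $\mathbb{F}_p^{2n}$ (where $\mathbb{F}_p=\mathbb{Z}/p\mathbb{Z}$) via $(u_1,\underline{u},w_1,\underline{w})\mapsto(\overline{u}_1,\underline{u},w_1,\underline{w})$, $\overline{u}_1$ being $u_1$ mod $p$; thus $End(G/\mathcal{Z}(G))=M_{2n}(\mathbb{F}_p)$. Each $\sigma\in End(G)$ preserves $\mathcal{Z}(G)$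 and induces $\overline{\sigma}\in M_{2n}(\mathbb{F}_p)$; $\Phi_2:Aut(G)\to Aut(G/\mathcal{Z}(G))=GL_{2n}(\mathbb{F}_p)$ is the map $\sigma\mapsto\overline{\sigma}$, which is the last map in the exact sequence. $Inn(G)$ is the group of inner automorphisms, $V^{\vee}$ the dual space. With $\Delta=\begin{pmatrix}0_{n\times n}&I_{n\times n}\\-I_{n\times n}&0_{n\times n}\end{pmatrix}$: $symp^{scalar}(2n,\mathbb{F}_p)=\{N\in M_{2n}(\mathbb{F}_p)\mid N^t\Delta N=l\Delta\text{ for some }l\in\mathbb{F}_p\}$ and $Sp^{scalar}(2n,\mathbb{F}_p)=\{M\in GL_{2n}(\mathbb{F}_p)\mid M^t\Delta M=l\Delta\text{ for some }l\in\mathbb{F}_p^{*}\}$. $Sp(2n-2,\mathbb{F}_p)$ is the usual symplectic group (trivial for $n=1$). *)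

(* Defs.v *)
From HB Require Import structures.
From mathcomp Require Import all_boot all_order all_algebra all_fingroup.
From mathcomp Require Import all_solvable.

Set Implicit Arguments.
Unset Strict Implicit.
Unset Printing Implicit Defensive.

Import GRing.Theory GroupScope.
Local Open Scope ring_scope.

(* ES2 p_pr m is ES_2(p, n) for n = m.+1, with es_u = (u_2, ..., u_n)^t and
   es_w = (w_2, ..., w_n)^t.  The primality proof is a parameter of the carrier so that the group laws
   below hold for every instance of the type. *)
Record ES2 (p : nat) (p_pr : prime p) (m : nat) := ES2El {
  es_u1 : 'Z_(p ^ 2);
  es_u : 'cV['F_p]_m;
  es_w1 : 'F_p;
  es_w : 'cV['F_p]_m
}.

Definition i21 (p : nat) (a : 'F_p) : 'Z_(p ^ 2) := (p * a)%:R.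

Definition red21 (p : nat) (x : 'Z_(p ^ 2)) : 'F_p := (nat_of_ord x)%:R.

Definition dotp (p m : nat) (u w : 'cV['F_p]_m) : 'F_p :=
  \sum_(i < m) u i 0 * w i 0.

Definition Delta (p n : nat) : 'M['F_p]_(n + n) :=
  block_mx 0 1%:M (- 1%:M) 0.

Definition symp_scalar (p n : nat) : {set 'M['F_p]_(n + n)} :=
  [set N | [exists l : 'F_p, N^T *m Delta p n *m N == l *: Delta p n]].

Definition Sp_scalar (p n : nat) : {set 'M['F_p]_(n + n)} :=
  [set M | (M \in unitmx) &&
     [exists l : 'F_p, (l != 0) && (M^T *m Delta p n *m M == l *: Delta p n)]].

(* Sp(2k, F_p); for k = 0 this is the singleton consisting of the 0 x 0
   matrix. *)
Definition Sp (p k : nat) : {set 'M['F_p]_(k + k)} :=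
  [set M | (M \in unitmx) && (M^T *m Delta p k *m M == Delta p k)].

Section Arith.
Variables (p : nat) (p_pr : prime p).

Let p_gt1 : (1 < p)%N. Proof. exact: prime_gt1. Qed.
Let p2_gt1 : (1 < p ^ 2)%N.
Proof. by rewrite (ltn_trans p_gt1) // -{1}[p]expn1 ltn_exp2l. Qed.

Lemma Fp_nat_modE (a : nat) : ((a %% p)%N%:R : 'F_p) = a%:R.
Proof. by apply/val_inj; rewrite /= !val_Fp_nat // modn_mod. Qed.

Lemma Fp_eqP (a b : nat) : (a%:R = b%:R :> 'F_p) -> a = b %[mod p].
Proof. by move=> /(congr1 val) /=; rewrite !val_Fp_nat. Qed.

Lemma Zp2_nat_modE (a : nat) : ((a %% (p ^ 2))%N%:R : 'Z_(p ^ 2)) = a%:R.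
Proof. by rewrite Zp_nat_mod. Qed.

Lemma i21_nat (a : nat) : i21 (a%:R : 'F_p) = (p * a)%:R.
Proof.
rewrite /i21 /= val_Fp_nat // muln_modr -[(p * p)%N]/(p ^ 2)%N.
by rewrite Zp_nat_mod.
Qed.

Lemma Fp_natrK (a : 'F_p) : (nat_of_ord a)%:R = a.
Proof. exact: natr_Zp. Qed.

Lemma Zp2_natrK (a : 'Z_(p ^ 2)) : (nat_of_ord a)%:R = a.
Proof. exact: natr_Zp. Qed.

Lemma red21_nat (a : nat) : red21 (a%:R : 'Z_(p ^ 2)) = a%:R.
Proof.
rewrite /red21 /= val_Zp_nat //.
rewrite -[LHS]Fp_nat_modE modn_dvdm ?Fp_nat_modE //.
by rewrite dvdn_exp.
Qed.

Lemma i21D (a b : 'F_p) : i21 (a + b) = i21 a + i21 b.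
Proof.
by rewrite -[a]Fp_natrK -[b]Fp_natrK -natrD !i21_nat mulnDr natrD.
Qed.

Lemma i210 : i21 (0 : 'F_p) = 0.
Proof. by rewrite -[0]/(0%:R) i21_nat muln0. Qed.

Lemma i21N (a : 'F_p) : i21 (- a) = - i21 a.
Proof. by apply/eqP; rewrite -addr_eq0 -i21D addNr i210. Qed.

Lemma red21D (x y : 'Z_(p ^ 2)) : red21 (x + y) = red21 x + red21 y.
Proof. by rewrite -[x]Zp2_natrK -[y]Zp2_natrK -natrD !red21_nat natrD. Qed.

Lemma i21_red (a : 'F_p) : red21 (i21 a) = 0.
Proof.
rewrite -[a]Fp_natrK i21_nat red21_nat natrM.
by rewrite [p%:R]pchar_Fp_0 ?mul0r.
Qed.

Lemma i21M (a : 'F_p) (x : 'Z_(p ^ 2)) : i21 a * x = i21 (a * red21 x).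
Proof.
rewrite -[a]Fp_natrK -[x]Zp2_natrK red21_nat -natrM !i21_nat -natrM.
by rewrite mulnA.
Qed.

Lemma i21_inj : injective (@i21 p).
Proof.
move=> a b; rewrite -[a]Fp_natrK -[b]Fp_natrK !i21_nat.
move=> /(congr1 val) /=; rewrite !val_Zp_nat // -[(p ^ 2)%N]/(p * p)%N.
rewrite -!muln_modr => /eqP; rewrite eqn_pmul2l ?prime_gt0 // => /eqP e.
by rewrite -[LHS]Fp_nat_modE e Fp_nat_modE.
Qed.

Lemma red21_eq0 (x : 'Z_(p ^ 2)) : red21 x = 0 -> exists a, x = i21 a.
Proof.
rewrite -[x]Zp2_natrK red21_nat => /(@Fp_eqP _ 0) /eqP.
rewrite mod0n => /dvdnP[k ->].
by exists k%:R; rewrite i21_nat mulnC.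
Qed.

Lemma dotpDl m (u v w : 'cV['F_p]_m) : dotp (u + v) w = dotp u w + dotp v w.
Proof.
by rewrite -big_split; apply: eq_bigr => i _; rewrite mxE mulrDl.
Qed.

Lemma dotpDr m (u v w : 'cV['F_p]_m) : dotp w (u + v) = dotp w u + dotp w v.
Proof.
by rewrite -big_split; apply: eq_bigr => i _; rewrite mxE mulrDr.
Qed.

Lemma dotp0l m (w : 'cV['F_p]_m) : dotp 0 w = 0.
Proof. by apply: big1 => i _; rewrite mxE mul0r. Qed.

Lemma dotp0r m (w : 'cV['F_p]_m) : dotp w 0 = 0.
Proof. by apply: big1 => i _; rewrite mxE mulr0. Qed.

Lemma dotpNl m (u w : 'cV['F_p]_m) : dotp (- u) w = - dotp u w.
Proof. by apply/eqP; rewrite -addr_eq0 -dotpDl addNr dotp0l. Qed.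

Lemma dotp_delta m (u : 'cV['F_p]_m) i : dotp u (delta_mx i 0) = u i 0.
Proof.
rewrite /dotp (bigD1 i) //= mxE !eqxx mulr1 big1 ?addr0 // => j ji.
by rewrite mxE (negbTE ji) mulr0.
Qed.

Lemma dotp_deltal m (u : 'cV['F_p]_m) i : dotp (delta_mx i 0) u = u i 0.
Proof.
by rewrite -dotp_delta; apply: eq_bigr => j _; rewrite mulrC.
Qed.

End Arith.

Section Group.
Variables (p : nat) (p_pr : prime p) (m : nat).
Local Notation ES := (ES2 p_pr m).

Definition ES2_prod (g : ES) := (es_u1 g, es_u g, es_w1 g, es_w g).
Definition prod_ES2 (t : 'Z_(p ^ 2) * 'cV['F_p]_m * 'F_p * 'cV['F_p]_m) : ES :=
  let: (u1, u, w1, w) := t in ES2El p_pr u1 u w1 w.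
Lemma ES2_prodK : cancel ES2_prod prod_ES2. Proof. by case. Qed.
HB.instance Definition _ := Equality.copy ES (can_type ES2_prodK).
HB.instance Definition _ := Choice.copy ES (can_type ES2_prodK).
HB.instance Definition _ := Countable.copy ES (can_type ES2_prodK).
HB.instance Definition _ := Finite.copy ES (can_type ES2_prodK).

Definition ES2_mul (g h : ES) : ES :=
  ES2El p_pr
    (es_u1 g + es_u1 h + i21 (es_w1 h) * es_u1 g + i21 (dotp (es_u g) (es_w h)))
    (es_u g + es_u h) (es_w1 g + es_w1 h) (es_w g + es_w h).

Definition ES2_one : ES := ES2El p_pr 0 0 0 0.

Definition ES2_inv (g : ES) : ES :=
  ES2El p_pr
    (- es_u1 g + i21 (es_w1 g) * es_u1 g + i21 (dotp (es_u g) (es_w g)))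
    (- es_u g) (- es_w1 g) (- es_w g).

Lemma ES2_mulA : associative ES2_mul.
Proof.
move=> [a u b w] [a' u' b' w'] [a'' u'' b'' w'']; rewrite /ES2_mul /=.
rewrite /= !i21M // !(red21D, i21_red) // !addr0 !dotpDl !dotpDr.
rewrite !(mulrDl, mulrDr, i21D) // !addrA; congr ES2El.
by rewrite [LHS](ACl (1*2*6*8*3*7*4*9*5))%AC.
Qed.

Lemma ES2_mul1 : left_id ES2_one ES2_mul.
Proof.
move=> [a u b w]; rewrite /ES2_mul /ES2_one /= dotp0l i210 // mulr0 !addr0.
by rewrite !add0r.
Qed.

Lemma ES2_mulV : left_inverse ES2_one ES2_inv ES2_mul.
Proof.
move=> [a u b w]; rewrite /ES2_mul /ES2_one /ES2_inv /= !addNr dotpNl i21N //.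
congr ES2El; rewrite i21M // [in i21 b * _]i21M // !(red21D, i21_red) // !addr0.
have redN : red21 (- a) = - red21 a.
  by apply/eqP; rewrite -addr_eq0 -red21D // addNr /red21.
rewrite redN mulrN i21N //.
set x := i21 (b * _); set y := i21 _.
by rewrite [LHS](ACl ((1*4)*(2*5)*(3*6)))%AC /= addNr !subrr !addr0.
Qed.

HB.instance Definition _ :=
  Finite_isGroup.Build ES ES2_mulA ES2_mul1 ES2_mulV.

End Group.

Section Quotient.
Variables (p : nat) (p_pr : prime p) (m : nat).
Local Notation ES := (ES2 p_pr m).
Local Notation G := [set: ES].
Local Notation Z := ('Z([set: ES]))%g.
Local Notation n := m.+1.

Definition es_vec (g : ES) : 'cV['F_p]_(n + n) :=
  col_mx (col_mx (red21 (es_u1 g))%:M (es_u g) : 'cV_(1 + m))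
         (col_mx (es_w1 g)%:M (es_w g) : 'cV_(1 + m)).

Definition es_lift (v : 'cV['F_p]_(n + n)) : ES :=
  let t := usubmx v : 'cV_(1 + m) in let b := dsubmx v : 'cV_(1 + m) in
  ES2El p_pr (nat_of_ord (t 0 0))%:R (dsubmx t) (b 0 0) (dsubmx b).

Lemma es_liftK : cancel es_lift es_vec.
Proof.
move=> v; rewrite /es_vec /es_lift /= red21_nat // Fp_natrK.
set t := usubmx v; set b := dsubmx v.
have E (x : 'cV['F_p]_(1 + m)) :
    col_mx (x 0 0)%:M (dsubmx x) = x :> 'cV_(1 + m).
  rewrite -[RHS]vsubmxK; congr col_mx; rewrite [LHS]mx11_scalar.
  rewrite [RHS]mx11_scalar !mxE /= mulr1n; congr (x _ _)%:M.
  exact/val_inj.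
by rewrite !E vsubmxK.
Qed.

Lemma es_vecM (g h : ES) : es_vec (g * h)%g = es_vec g + es_vec h.
Proof.
case: g h => [a u b w] [a' u' b' w'].
rewrite /es_vec add_col_mx /= i21M // !red21D // !i21_red // !addr0.
have E (x y : 'F_p) (v v' : 'cV['F_p]_m) : (col_mx (x + y)%:M (v + v') =
    col_mx x%:M v + col_mx y%:M v' :> 'cV_(1 + m)).
  by rewrite add_col_mx raddfD.
by rewrite !E.
Qed.

Lemma es_vec1 : es_vec 1%g = 0.
Proof.
by apply: (addrI (es_vec 1%g)); rewrite -es_vecM mulg1 addr0.
Qed.

Lemma es_vecX (g : ES) k : es_vec (g ^+ k)%g = es_vec g *+ k.
Proof.
by elim: k => [|k IH]; rewrite ?expg0 ?es_vec1 // expgS es_vecM IH mulrS.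
Qed.

Lemma es_vec_eq0 (g : ES) : es_vec g = 0 ->
  exists a : 'F_p, g = ES2El p_pr (i21 a) 0 0 0.
Proof.
case: g => [x u b w]; rewrite /es_vec /=.
have E (c : 'F_p) (v : 'cV['F_p]_m) :
    col_mx c%:M v = 0 :> 'cV_(1 + m) -> c = 0 /\ v = 0.
  rewrite -[0]col_mx0 => /eq_col_mx[/matrixP/(_ 0 0) c0 ->]; split=> //.
  by move: c0; rewrite !mxE mulr1n.
rewrite -[0]col_mx0 => /eq_col_mx[/E[/(red21_eq0 p_pr)[a ->] ->] /E[-> ->]].
by exists a.
Qed.

Lemma es_comm (g h : ES) : (g * h)%g = (h * g)%g <->
  es_w1 h * red21 (es_u1 g) + dotp (es_u g) (es_w h) =
  es_w1 g * red21 (es_u1 h) + dotp (es_u h) (es_w g).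
Proof.
case: g h => [a u b w] [a' u' b' w'] /=.
have E : (ES2El p_pr a u b w * ES2El p_pr a' u' b' w')%g =
   ES2El p_pr (a + a' + i21 (b' * red21 a + dotp u w')) (u + u') (b + b')
     (w + w').
  by rewrite i21D // -i21M // addrA.
have E' : (ES2El p_pr a' u' b' w' * ES2El p_pr a u b w)%g =
   ES2El p_pr (a + a' + i21 (b * red21 a' + dotp u' w)) (u + u') (b + b')
     (w + w').
  rewrite i21D // -i21M // addrA (addrC a) (addrC u) (addrC b) (addrC w) //.
rewrite E E'; split=> [/(congr1 (@es_u1 _ _ _)) /= e|-> //].
exact/(i21_inj p_pr)/(addrI (a + a')).
Qed.

Lemma es_centerP (g : ES) :
  reflect (exists a : 'F_p, g = ES2El p_pr (i21 a) 0 0 0) (g \in Z).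
Proof.
apply: (iffP idP) => [/centerP[_ cg]|[a ->]]; last first.
  apply/centerP; split=> [|h _]; first by rewrite inE.
  by apply/es_comm; rewrite /= i21_red // !mulr0 !mul0r dotp0l dotp0r.
apply: es_vec_eq0; case: g cg => x u b w cg.
have cc (h : ES) : es_w1 h * red21 x + dotp u (es_w h) =
            b * red21 (es_u1 h) + dotp (es_u h) w.
  by have /es_comm := cg h (in_setT h).
have r0 : red21 (0 : 'Z_(p ^ 2)) = 0 by [].
have r1 : red21 (1 : 'Z_(p ^ 2)) = 1.
  by rewrite -[1]/(1%:R) red21_nat.
have x0 : red21 x = 0.
  by have := cc (ES2El p_pr 0 0 1 0); rewrite /= dotp0l dotp0r r0 mulr0 !addr0 mul1r.
have b0 : b = 0.
  have := cc (ES2El p_pr 1 0 0 0).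
  by rewrite /= dotp0l dotp0r r1 mul0r !addr0 mulr1.
have u0 : u = 0.
  apply/colP=> i; have := cc (ES2El p_pr 0 0 0 (delta_mx i 0)).
  by rewrite /= dotp0l dotp_delta r0 mul0r mulr0 !add0r !mxE.
have w0 : w = 0.
  apply/colP=> i; have := cc (ES2El p_pr 0 (delta_mx i 0) 0 0).
  by rewrite /= dotp0r dotp_deltal r0 mul0r mulr0 !add0r !mxE.
by rewrite /es_vec /= x0 b0 u0 w0 !raddf0 !col_mx0.
Qed.

Lemma es_vec_ker (g : ES) : (g \in Z) = (es_vec g == 0).
Proof.
apply/es_centerP/eqP => [[a ->]|]; last exact: es_vec_eq0.
by rewrite /es_vec /= i21_red // !raddf0 !col_mx0.
Qed.

Lemma es_normZ (g : ES) : g \in ('N(Z))%g.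
Proof. by apply: (subsetP (normal_norm (center_normal _))); rewrite inE. Qed.

(* The identification of G / Z(G) with F_p^(2n); see es_quo_vecE,
   es_quo_vecM and es_quo_vec_inj below. *)
Definition es_quo_vec (x : coset_of Z) : 'cV['F_p]_(n + n) := es_vec (repr x).

Lemma es_quo_vecE (g : ES) : es_quo_vec (coset Z g) = es_vec g.
Proof.
rewrite /es_quo_vec; have := mem_repr_coset (coset Z g).
rewrite val_coset ?es_normZ // => /rcosetP[z Zz ->].
by rewrite es_vecM; move: Zz; rewrite es_vec_ker => /eqP->; rewrite add0r.
Qed.

Lemma es_coset_repr (x : coset_of Z) : coset Z (repr x) = x.
Proof. exact: coset_reprK. Qed.

Lemma es_quo_vecM (x y : coset_of Z) :
  es_quo_vec (x * y)%g = es_quo_vec x + es_quo_vec y.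
Proof.
rewrite -[x]es_coset_repr -[y]es_coset_repr -morphM ?es_normZ //=.
by rewrite !es_quo_vecE es_vecM.
Qed.

Lemma es_quo_vec1 : es_quo_vec 1%g = 0.
Proof.
by apply: (addrI (es_quo_vec 1%g)); rewrite -es_quo_vecM mulg1 addr0.
Qed.

Lemma es_quo_vec_inj : injective es_quo_vec.
Proof.
move=> x y exy; apply/eqP; rewrite eq_mulgV1; set z := (x * _)%g.
have : es_quo_vec z = 0.
  apply: (addIr (es_quo_vec y)).
  by rewrite -es_quo_vecM mulgKV add0r.
rewrite -[z]es_coset_repr es_quo_vecE => /eqP; rewrite -es_vec_ker => zZ.
by rewrite coset_id.
Qed.

Lemma es_quo_liftK v : es_quo_vec (coset Z (es_lift v)) = v.
Proof. by rewrite es_quo_vecE es_liftK. Qed.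

(* The matrix of an endomorphism of G / Z(G), acting on column vectors. *)
Definition quo_mx (phi : coset_of Z -> coset_of Z) : 'M['F_p]_(n + n) :=
  \matrix_(i, j) es_quo_vec (phi (coset Z (es_lift (delta_mx j 0)))) i 0.

Lemma quo_mxE (phi : coset_of Z -> coset_of Z) :
  {morph phi : x y / (x * y)%g} ->
  forall x, es_quo_vec (phi x) = quo_mx phi *m es_quo_vec x.
Proof.
move=> phiM x; pose psi v := es_quo_vec (phi (coset Z (es_lift v))).
have psiD v w : psi (v + w) = psi v + psi w.
  rewrite /psi -es_quo_vecM -phiM; congr (es_quo_vec (phi _)).
  by apply: es_quo_vec_inj; rewrite es_quo_vecM !es_quo_liftK.
have psi0 : psi 0 = 0 by apply: (addrI (psi 0)); rewrite -psiD !addr0.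
have psiX v k : psi (v *+ k) = psi v *+ k.
  by elim: k => [|k IH]; rewrite ?mulr0n // !mulrS psiD IH.
have psiZ a v : psi (a *: v) = a *: psi v.
  by rewrite -[a](Fp_natrK) !scaler_nat psiX.
have -> : es_quo_vec (phi x) = psi (es_quo_vec x).
  by congr (es_quo_vec (phi _)); apply: es_quo_vec_inj; rewrite es_quo_liftK.
rewrite [in LHS](matrix_sum_delta (es_quo_vec x)).
rewrite (big_morph psi psiD psi0); apply/colP=> i; rewrite summxE mxE.
apply: eq_bigr => j _; rewrite big_ord1 psiZ !mxE mulrC /psi.
by congr (_ * _).
Qed.

Lemma quo_mx_uniq (phi : coset_of Z -> coset_of Z) (M : 'M['F_p]_(n + n)) :
  (forall x, es_quo_vec (phi x) = M *m es_quo_vec x) -> quo_mx phi = M.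
Proof.
by move=> phiE; apply/matrixP=> i j; rewrite mxE phiE es_quo_liftK -colE mxE.
Qed.

(* The map of G / Z(G) induced by a map of G; see quo_mapE. *)
Definition quo_map (f : ES -> ES) (x : coset_of Z) : coset_of Z :=
  coset Z (f (repr x)).

Lemma morph_center (f : ES -> ES) : {morph f : x y / (x * y)%g} ->
  forall z, z \in Z -> f z \in Z.
Proof.
move=> fM z /es_centerP[a ->]; rewrite es_vec_ker.
pose h : ES := ES2El p_pr (nat_of_ord a)%:R 0 0 0.
have hX k : (h ^+ k)%g = ES2El p_pr (nat_of_ord a * k)%:R 0 0 0.
  elim: k => [|k IH]; first by rewrite muln0.
  rewrite expgS IH; congr ES2El; rewrite /= ?addr0 //.
  by rewrite dotp0l i210 // mul0r !addr0 -natrD mulnS.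
have -> : ES2El p_pr (i21 a) 0 0 0 = (h ^+ p)%g by rewrite hX mulnC.
have f1 : f 1%g = 1%g by apply: (mulgI (f 1%g)); rewrite -fM !mulg1.
have fX k : f (h ^+ k)%g = (f h ^+ k)%g.
  by elim: k => [|k IH]; rewrite ?expg0 // !expgS fM IH.
rewrite fX es_vecX -scaler_nat [p%:R]pchar_Fp_0 //.
by rewrite scale0r.
Qed.

Lemma quo_mapE (f : ES -> ES) : {morph f : x y / (x * y)%g} ->
  forall g, quo_map f (coset Z g) = coset Z (f g).
Proof.
move=> fM g; rewrite /quo_map; have := mem_repr_coset (coset Z g).
rewrite val_coset ?es_normZ // => /rcosetP[z Zz ->].
by rewrite fM coset_kerl // morph_center.
Qed.

Lemma quo_mapM (f : ES -> ES) : {morph f : x y / (x * y)%g} ->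
  {morph quo_map f : x y / (x * y)%g}.
Proof.
move=> fM x y; rewrite -[x]es_coset_repr -[y]es_coset_repr.
by rewrite -morphM ?es_normZ //= !quo_mapE // fM morphM ?es_normZ.
Qed.

Lemma quo_map_mxE (f : ES -> ES) : {morph f : x y / (x * y)%g} ->
  forall g, es_vec (f g) = quo_mx (quo_map f) *m es_vec g.
Proof.
move=> fM g; rewrite -!es_quo_vecE -quo_mapE //.
exact/quo_mxE/quo_mapM.
Qed.

(* The default value 1 is only taken outside Aut(G); see Phi2E. *)
Definition Phi2 (s : {perm ES}) : {perm coset_of Z} :=
  odflt 1%g [pick t : {perm coset_of Z} | [forall x, t x == quo_map s x]].

Lemma Aut_morph (s : {perm ES}) : s \in Aut G -> {morph s : x y / (x * y)%g}.
Proof. by move=> /Aut_morphic/morphicP sM x y; rewrite sM ?inE. Qed.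

Lemma Phi2E (s : {perm ES}) : s \in Aut G -> Phi2 s =1 quo_map s.
Proof.
move=> sA x; rewrite /Phi2; case: pickP => [t /forallP/(_ x)/eqP //|].
have sM := Aut_morph sA; have s'M := Aut_morph (groupVr sA).
have inj : injective (quo_map s).
  apply: (can_inj (g := quo_map s^-1%g)) => y.
  by rewrite -[y]es_coset_repr !quo_mapE // permK.
by move/(_ (perm inj))/forallP; case=> y; rewrite permE.
Qed.

Lemma Phi2M : {in Aut G &, {morph Phi2 : s t / (s * t)%g}}.
Proof.
move=> s t sA tA; apply/permP=> x; rewrite permM !Phi2E ?groupM //.
rewrite -[x]es_coset_repr !quo_mapE ?permM //; apply: Aut_morph => //.
exact: groupM.
Qed.

Canonical Phi2_morphism := Morphism Phi2M.

Lemma Phi2_Aut : Phi2 @* Aut G \subset Aut (G / Z)%g.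
Proof.
have GZ : (G / Z)%g = setT.
  apply/setP=> x; rewrite inE -[x]es_coset_repr mem_quotient ?inE //.
apply/subsetP=> _ /morphimP[s _ sA ->]; rewrite inE; apply/andP; split.
  by apply/subsetP=> x _; rewrite GZ inE.
apply/morphicP=> x y _ _; rewrite !Phi2E //.
exact/quo_mapM/Aut_morph.
Qed.

Lemma Phi2_morph (s : {perm ES}) : s \in Aut G ->
  {morph Phi2 s : x y / (x * y)%g}.
Proof.
move=> sA x y; rewrite (Phi2E sA) (Phi2E sA x) (Phi2E sA y).
exact: (quo_mapM (Aut_morph sA)).
Qed.

(* Im(Phi2), and its elements read as matrices. *)
Definition im_Phi2 : {set {perm coset_of Z}} := Phi2 @* Aut G.
Definition im_Phi2_mx : {set 'M['F_p]_(n + n)} :=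
  [set quo_mx t | t : {perm coset_of Z} in im_Phi2].

(* Composition of permutations is written left to right in MathComp, and a
   linear map acts on columns by left multiplication. *)
Lemma Phi2_mxM (s t : {perm ES}) : s \in Aut G -> t \in Aut G ->
  quo_mx (Phi2 (s * t)%g) = quo_mx (Phi2 t) *m quo_mx (Phi2 s).
Proof.
move=> sA tA; apply: quo_mx_uniq => x.
rewrite (Phi2M sA tA) permM -mulmxA (quo_mxE (Phi2_morph tA)).
by rewrite (quo_mxE (Phi2_morph sA)).
Qed.

Lemma card_im_Phi2_mx : #|im_Phi2_mx| = #|im_Phi2|.
Proof.
apply: card_in_imset => _ _ /morphimP[s _ sA ->] /morphimP[t _ tA ->] e.
apply/permP=> x; apply: es_quo_vec_inj.
rewrite (quo_mxE (Phi2_morph sA)) e.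
by rewrite (quo_mxE (Phi2_morph tA)).
Qed.

Definition End_ES2 : {set {ffun ES -> ES}} :=
  [set f : {ffun ES -> ES} | morphic G f].

(* The image of End(G) -> End(G / Z(G)) read as matrices. *)
Definition im_End_mx : {set 'M['F_p]_(n + n)} :=
  [set quo_mx (quo_map f) | f : {ffun ES -> ES} in End_ES2].

Definition Inn_ES2 : {set {perm ES}} := conj_aut G @* G.

End Quotient.

(* Main.v *)
Require Import Defs.
From HB Require Import structures.
From mathcomp Require Import all_boot all_order all_algebra all_fingroup.
From mathcomp Require Import all_solvable.
From mathcomp Require Import ring.

(* In G one has gh = hg z^(omega(v, v')) and g^p = z^(v_1), where v, v' are the
   images of g, h in F_p^(2n), omega is the form with matrix Delta and z
   generates the centre.  If an endomorphism maps z to z^l, its matrix M thus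
   satisfies M^t Delta M = l Delta and e_1^t M = l e_1^t.  Conversely such an M
   is lifted by (x, v) |-> (l x + p q(v), M v), where q is half the quadratic
   form of the symmetric bilinear form that measures the failure of M to
   multiply by l the cocycle defining G; this uses that p is odd.

   For l <> 0 the condition on the first row says that M fixes e_(n+1), so the
   image of Aut(G) is F_p^* times the stabiliser of e_(n+1) in Sp(2n).  The
   orders follow by orbit counting with transvections, first on the nonzero
   vectors and then on the vectors v with omega(v, e_(n+1)) = 1. *)

Set Implicit Arguments.
Unset Strict Implicit.
Unset Printing Implicit Defensive.

Import GRing.Theory GroupScope.
Local Open Scope ring_scope.

(** * Counting symplectic similitudes *)

Section Symplectic.
Variables (p : nat) (n : nat).
Local Notation F := 'F_p.
Local Notation V := 'cV[F]_(n + n).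
Local Notation D := (Delta p n).

(** * The symplectic form and its nondegeneracy *)

Definition omega (v w : V) : F := (v^T *m D *m w) 0 0.

(** The bilinear cocycle of the group law, pairing the u-half of [v] with the w-half of [w]; [omega]
    is its antisymmetrisation. *)
Definition isotr (v w : V) : F := dotp (usubmx v) (dsubmx w).

Lemma dotpE k (u w : 'cV[F]_k) : dotp u w = (u^T *m w) 0 0.
Proof. by rewrite !mxE; apply: eq_bigr => i _; rewrite mxE. Qed.

Lemma omegaE v w : omega v w = isotr v w - isotr w v.
Proof.
rewrite /omega /isotr -[v in LHS]vsubmxK -[w in LHS]vsubmxK tr_col_mx.
rewrite mul_row_block !mulmx0 mulmx1 mulmxN mulmx1 addr0 add0r mul_row_col.
rewrite !dotpE mulNmx addrC !mxE; congr (_ - _).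
by apply: eq_bigr => i _; rewrite !mxE mulrC.
Qed.

Lemma isotrDl u v w : isotr (u + v) w = isotr u w + isotr v w.
Proof. by rewrite /isotr linearD dotpDl. Qed.

Lemma isotrDr u v w : isotr w (u + v) = isotr w u + isotr w v.
Proof. by rewrite /isotr linearD dotpDr. Qed.

Lemma omegaDl u v w : omega (u + v) w = omega u w + omega v w.
Proof. by rewrite /omega linearD !mulmxDl mxE. Qed.

Lemma omegaDr u v w : omega w (u + v) = omega w u + omega w v.
Proof. by rewrite /omega mulmxDr mxE. Qed.

Lemma omegaZl a v w : omega (a *: v) w = a * omega v w.
Proof. by rewrite /omega linearZ -!scalemxAl mxE. Qed.

Lemma omegaZr a v w : omega v (a *: w) = a * omega v w.
Proof. by rewrite /omega -scalemxAr mxE. Qed.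

Lemma omegaC v w : omega w v = - omega v w.
Proof. by rewrite !omegaE opprB. Qed.

Lemma omegavv v : omega v v = 0.
Proof. by rewrite omegaE subrr. Qed.

Lemma Delta_sqr : D *m D = - 1%:M.
Proof.
rewrite /Delta mulmx_block !mul0mx !mulmx0 !add0r !addr0 mul1mx mulmx1.
by rewrite scalar_mx_block opp_block_mx oppr0 ?mulmxN ?mulNmx ?mulmx1 ?mul1mx.
Qed.

Lemma Delta_unit : D \in unitmx.
Proof.
have : D *m - D = 1%:M by rewrite mulmxN Delta_sqr opprK.
by case/mulmx1_unit.
Qed.

Lemma tr_delta_mul k j (X : 'M[F]_(n + n, k)) i i' :
  ((delta_mx i 0 : V)^T *m X) i' j = X i j.
Proof. by rewrite trmx_delta ord1 -rowE mxE. Qed.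

Lemma mx_formP (A B : 'M[F]_(n + n)) :
  (forall v w : V, (v^T *m A *m w) 0 0 = (v^T *m B *m w) 0 0) -> A = B.
Proof.
move=> AB; apply/matrixP=> i j.
have := AB (delta_mx i 0) (delta_mx j 0).
by rewrite -!colE [LHS]mxE [RHS]mxE !tr_delta_mul.
Qed.

Lemma omega_nondeg v : v != 0 -> exists w, omega v w != 0.
Proof.
move=> v0; have : v^T *m D != 0.
  apply: contraNneq v0 => vD; rewrite -[v]trmxK -[v^T](mulmxK Delta_unit) vD.
  by rewrite mul0mx trmx0.
case/rV0Pn=> j vDj; exists (delta_mx j 0).
by rewrite /omega -colE mxE.
Qed.

(** * Similitudes, the symplectic group and its transitivity on vectors *)

Definition similitude (l : F) (M : 'M[F]_(n + n)) := M^T *m D *m M == l *: D.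

Lemma similitudeP l M :
  reflect (forall v w, omega (M *m v) (M *m w) = l * omega v w) (similitude l M).
Proof.
apply: (iffP eqP) => [MD v w|Ml].
  rewrite /omega trmx_mul -mulmxA mulmxA -[v^T *m _ *m _]mulmxA.
  by rewrite mulmxA -[v^T *m _ *m M]mulmxA MD -scalemxAr -scalemxAl mxE.
refine (mx_formP _) => v w; rewrite -scalemxAr -scalemxAl [RHS]mxE.
by apply: etrans (Ml v w); rewrite /omega trmx_mul !mulmxA.
Qed.

(** Since Delta^2 = -1, the relation M^T Delta M = l Delta exhibits -l^(-1) Delta M^T Delta as a
    left inverse of [M]. *)
Lemma similitude_unit l M : l != 0 -> similitude l M -> M \in unitmx.
Proof.
move=> l0 /eqP MD.
have : (- l^-1 *: (D *m M^T *m D)) *m M = 1%:M.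
  rewrite -scalemxAl -!mulmxA [M^T *m _]mulmxA MD -scalemxAr scalerA mulNr.
  by rewrite mulVf // scaleN1r Delta_sqr opprK.
by case/mulmx1_unit.
Qed.

Lemma mem_Sp M : (M \in Sp p n) = similitude 1 M.
Proof.
rewrite inE /similitude scale1r; case: (boolP (_ == _)); rewrite ?andbF // => MD.
by rewrite andbT (@similitude_unit 1) ?oner_eq0 // /similitude scale1r.
Qed.

Lemma similitudeM l k M N :
  similitude l M -> similitude k N -> similitude (l * k) (M *m N).
Proof.
move=> /similitudeP Ml /similitudeP Nk; apply/similitudeP=> v w.
by rewrite -!mulmxA Ml Nk mulrA.
Qed.

Lemma similitudeV l M : l != 0 -> similitude l M -> similitude l^-1 (invmx M).
Proof.
move=> l0 Ml; have uM := similitude_unit l0 Ml; move/similitudeP: Ml => Ml.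
apply/similitudeP=> v w; apply: (mulfI l0).
by rewrite -Ml !mulmxA !mulmxV // !mul1mx mulVKf.
Qed.

Lemma Sp_mul M N : M \in Sp p n -> N \in Sp p n -> M *m N \in Sp p n.
Proof. by rewrite !mem_Sp => SM SN; rewrite -[1]mulr1 similitudeM. Qed.

Lemma Sp_inv M : M \in Sp p n -> invmx M \in Sp p n.
Proof. by rewrite !mem_Sp => SM; rewrite -invr1 similitudeV ?oner_eq0. Qed.

Lemma Sp_unit M : M \in Sp p n -> M \in unitmx.
Proof. by rewrite inE => /andP[]. Qed.

(* The transvection along [v - v'] that maps [v] to [v']. *)
Lemma Sp_transvection (v v' : V) : omega v v' != 0 ->
  exists2 M, M \in Sp p n &
    M *m v = v' /\ (forall x, omega x v = omega x v' -> M *m x = x).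
Proof.
move=> vv'; have [a aE] : exists a, a = v - v' by eexists.
(* As omega(a, v) = omega(v, v'), this value of [c] gives M v = v - a = v'. *)
pose c := - (omega v v')^-1.
pose M : 'M[F]_(n + n) := 1%:M + c *: (a *m (a^T *m D)).
have ME x : M *m x = x + (c * omega a x) *: a.
  rewrite mulmxDl mul1mx -scalemxAl -mulmxA -scalerA.
  by rewrite [a^T *m D *m x]mx11_scalar mul_mx_scalar.
have omegaNl x y : omega (- x) y = - omega x y.
  by rewrite -scaleN1r omegaZl mulN1r.
exists M; last split.
- rewrite mem_Sp; apply/similitudeP=> x y; rewrite !ME.
  rewrite !(omegaDl, omegaDr, omegaZl, omegaZr) omegavv (omegaC a x).
  by ring.
- rewrite ME aE omegaDl omegaNl omegavv sub0r -omegaC.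
  by rewrite mulNr mulVf // scaleN1r opprB addrC subrK.
- move=> x xv; rewrite ME aE omegaDl omegaNl (omegaC x v) (omegaC x v') xv.
  by rewrite opprK addNr mulr0 scale0r addr0.
Qed.

(** When omega(v, v') = 0, two transvections are composed through a vector [u] orthogonal to
    neither. *)
Lemma Sp_trans (v v' : V) : v != 0 -> v' != 0 ->
  exists2 M, M \in Sp p n & M *m v = v'.
Proof.
move=> v0 v'0; have [vv'|] := eqVneq (omega v v') 0; last first.
  by case/Sp_transvection=> M SM [Mv _]; exists M.
suff [u vu uv'] : exists2 u, omega v u != 0 & omega v' u != 0.
  have {}uv' : omega u v' != 0 by rewrite omegaC oppr_eq0.
  have [M SM [Mv _]] := Sp_transvection vu.
  have [N SN [Nu _]] := Sp_transvection uv'.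
  by exists (N *m M); rewrite ?Sp_mul // -mulmxA Mv.
(* With x not orthogonal to v and y not orthogonal to v', one of x, y, x + y serves as [u]. *)
have [x vx] := omega_nondeg v0; have [y vy] := omega_nondeg v'0.
have [v'x|] := eqVneq (omega v' x) 0; last by exists x.
have [vy0|] := eqVneq (omega v y) 0; last by exists y.
by exists (x + y); rewrite omegaDr ?v'x ?vy0 ?addr0 ?add0r.
Qed.

(* If [omega v v' = 0], one passes through [v + f]. *)
Lemma Sp_stab_trans (f v v' : V) : omega v f = 1 -> omega v' f = 1 ->
  exists2 M, M \in Sp p n & M *m f = f /\ M *m v = v'.
Proof.
move=> vf v'f.
(* The transvection from x to y fixes [f] because [f] pairs equally with both. *)
have step x y : omega x f = 1 -> omega y f = 1 -> omega x y != 0 ->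
    exists2 M, M \in Sp p n & M *m f = f /\ M *m x = y.
  move=> xf yf /Sp_transvection[M SM [Mx Mf]]; exists M => //; split=> //.
  by apply: Mf; rewrite omegaC xf omegaC yf.
have [vv'|] := eqVneq (omega v v') 0; last exact: step.
have vff : omega (v + f) f = 1 by rewrite omegaDl omegavv addr0.
have [|M SM [Mf Mv]] := step v (v + f) vf vff.
  by rewrite omegaDr omegavv add0r vf oner_eq0.
have [|N SN [Nf Nv]] := step (v + f) v' vff v'f.
  by rewrite omegaDl vv' add0r omegaC v'f oppr_eq0 oner_eq0.
by exists (N *m M); rewrite ?Sp_mul // -!mulmxA Mf Mv Nf.
Qed.

End Symplectic.

(** * Orbit counting in the symplectic group *)

Lemma card_orbit_stab (R : finComUnitRingType) k (S : {set 'M[R]_k}) (v : 'cV[R]_k)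
    (O : {set 'cV[R]_k}) :
  {in S, forall M, M \in unitmx /\ invmx M \in S} ->
  {in S &, forall M N, M *m N \in S} ->
  {in S, forall M, M *m v \in O} ->
  {in O, forall w, exists2 M, M \in S & M *m v = w} ->
  #|S| = (#|O| * #|[set M in S | M *m v == v]|)%N.
Proof.
move=> SV SM SO OS; rewrite -sum1_card (partition_big (fun M => M *m v) (mem O)) //=.
rewrite -sum_nat_const; apply: eq_bigr => w /OS[N NS Nv].
have [uN N'S] := SV N NS.
(* The fibre of M |-> M v over w is the translate of the stabiliser by any N with N v = w. *)
have injN : injective (mulmx N : 'M_k -> _) := can_inj (mulKmx uN).
rewrite sum1dep_card -[RHS](card_imset _ injN).
apply: eq_card => M; apply/idP/imsetP=> [|[M']]; rewrite !inE.
  move=> /andP[MS /eqP Mv]; exists (invmx N *m M); last by rewrite mulKVmx.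
  by rewrite inE SM //= -mulmxA Mv -Nv mulKmx.
by case/andP=> M'S /eqP M'v ->; rewrite SM //= -mulmxA M'v Nv.
Qed.

Section CardSp.
Variables (p : nat) (p_pr : prime p).
Local Notation F := 'F_p.

Section Fixf.
Variable m : nat.
Local Notation n := m.+1.
Local Notation V := 'cV[F]_(n + n).

(** [evec] and [fvec] are e_1 and e_(n+1), a hyperbolic pair: omega(e, f) = 1. *)
Definition evec : V := delta_mx (lshift n 0) 0.
Definition fvec : V := delta_mx (rshift n 0) 0.

Lemma omega_fvec v : omega v fvec = v (lshift n 0) 0.
Proof.
rewrite omegaE /isotr !dotpE.
have -> : dsubmx fvec = delta_mx 0 0.
  by apply/colP=> i; rewrite !mxE !eqxx !andbT (inj_eq (@rshift_inj _ _)).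
have -> : usubmx fvec = 0 by apply/colP=> i; rewrite !mxE eq_lrshift.
by rewrite trmx0 mul0mx -colE !mxE subr0.
Qed.

Lemma card_V : #|{: V}| = (p ^ (2 * n))%N.
Proof. by rewrite card_mx card_Fp // muln1 mul2n addnn. Qed.

(** Translations by multiples of [evec] identify the p level sets of omega(-, f). Both sides are
    multiplied by p to avoid a division. *)
Lemma card_coord_eq1 : #|[set v : V | omega v fvec == 1]| = (p ^ (2 * n - 1))%N.
Proof.
have p0 := prime_gt0 p_pr; apply/eqP; rewrite -(eqn_pmul2l p0) -expnS; apply/eqP.
transitivity #|{: V}|; last by rewrite card_V subn1.
rewrite -[#|{: V}|]sum1_card (partition_big (fun v => omega v fvec) xpredT) //=.
rewrite -[X in (X * _)%N](card_Fp p_pr) -sum_nat_const.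
apply: eq_bigr => a _; rewrite sum1dep_card.
rewrite -[LHS](card_imset _ (@addIr _ ((a - 1) *: evec))).
have oe : omega evec fvec = 1 by rewrite omega_fvec mxE !eqxx.
apply: eq_card => v; rewrite !inE; apply/imsetP/eqP => [[w]|va].
  by rewrite inE => /eqP w1 ->; rewrite omegaDl omegaZl w1 oe mulr1 addrC subrK.
exists (v - (a - 1) *: evec); last by rewrite subrK.
by rewrite inE omegaDl -scaleNr omegaZl va oe mulr1 opprB addrC subrK.
Qed.

Definition Sp_fix : {set 'M[F]_(n + n)} := [set M in Sp p n | M *m fvec == fvec].

(** The orbit of f consists of all nonzero vectors. *)
Lemma card_Sp_fix_f : #|Sp p n| = ((p ^ (2 * n) - 1) * #|Sp_fix|)%N.
Proof.
have f0 : fvec != 0.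
  by apply/cV0Pn; exists (rshift n 0); rewrite mxE !eqxx oner_eq0.
have -> : (p ^ (2 * n) - 1)%N = #|[set v : V | v != 0]|.
  rewrite (_ : [set v : V | v != 0] = ~: [set 0]); last by apply/setP=> v; rewrite !inE.
  by rewrite cardsCs setCK cards1 card_V.
apply: card_orbit_stab => [M SM|M N|M SM|v].
- by rewrite Sp_unit ?Sp_inv.
- exact: Sp_mul.
- rewrite inE; apply: contraNneq f0 => Mf; rewrite -[fvec](mulKmx (Sp_unit SM)).
  by rewrite Mf mulmx0.
- by rewrite inE; apply: Sp_trans.
Qed.

(** The orbit of e under the stabiliser of f is the set of v with omega(v, f) = 1. *)
Lemma card_Sp_fix_ef :
  #|Sp_fix| = (p ^ (2 * n - 1) * #|[set M in Sp_fix | M *m evec == evec]|)%N.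
Proof.
rewrite -card_coord_eq1.
have oe : omega evec fvec = 1 by rewrite omega_fvec mxE !eqxx.
have SpP M v w : M \in Sp p n -> omega (M *m v) (M *m w) = omega v w.
  by rewrite mem_Sp => /similitudeP ->; rewrite mul1r.
apply: card_orbit_stab => [M|M N|M|v].
- case/setIdP=> SM /eqP Mf.
  have uM := Sp_unit SM; split=> //; apply/setIdP; split; first exact: Sp_inv.
  by rewrite -{1}Mf mulKmx.
- case/setIdP=> SM /eqP Mf /setIdP[SN /eqP Nf]; apply/setIdP.
  by rewrite Sp_mul // -mulmxA Nf Mf.
- by case/setIdP=> SM /eqP Mf; rewrite inE -{1}Mf SpP // oe.
- rewrite inE => /eqP vf; have [M SM [Mf Me]] := Sp_stab_trans oe vf.
  by exists M => //; apply/setIdP; rewrite Mf.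
Qed.

(** * Splitting off the hyperbolic plane spanned by e and f *)

Let r1 : 'rV[F]_(1 + m) := delta_mx 0 0.

Let r1E : r1 = row_mx 1%:M 0.
Proof.
have -> : 1%:M = delta_mx 0 0 :> 'M[F]_1 by rewrite [RHS]mx11_scalar mxE !eqxx.
by rewrite -delta_mx_lshift; congr delta_mx; apply: val_inj.
Qed.

(** [R] drops the first coordinate, so [Pi] deletes the coordinates of e and f, and [Pi^T] embeds
    F_p^(2m) as the orthogonal complement of the plane. *)
Let R : 'M[F]_(m, 1 + m) := row_mx 0 1%:M.
Let Pi : 'M[F]_(m + m, n + n) := block_mx R 0 0 R.

Let RRt : R *m R^T = 1%:M.
Proof. by rewrite tr_row_mx mul_row_col trmx0 trmx1 mul0mx mulmx1 add0r. Qed.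

Let Rr1 : R *m r1^T = 0.
Proof. by rewrite r1E tr_row_mx mul_row_col trmx0 mul0mx mulmx0 addr0. Qed.

Let r1r1 : r1 *m r1^T = 1%:M.
Proof. by rewrite r1E tr_row_mx mul_row_col trmx0 trmx1 mul0mx mulmx1 addr0. Qed.

Let RtR : R^T *m R + r1^T *m r1 = 1%:M.
Proof.
rewrite r1E !tr_row_mx !mul_col_row !trmx0 !trmx1 !(mul0mx, mulmx0) !mulmx1.
by rewrite add_block_mx !addr0 !add0r -scalar_mx_block.
Qed.

Let evecE : evec = col_mx r1^T 0.
Proof. by rewrite /evec delta_mx_ushift trmx_delta. Qed.

Let fvecE : fvec = col_mx 0 r1^T.
Proof. by rewrite /fvec delta_mx_dshift trmx_delta. Qed.

Let PiPit : Pi *m Pi^T = 1%:M.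
Proof.
rewrite tr_block_mx mulmx_block !trmx0 !(mul0mx, mulmx0) !addr0 !add0r RRt.
by rewrite -scalar_mx_block.
Qed.

Let Pie : Pi *m evec = 0.
Proof. by rewrite evecE mul_block_col Rr1 !(mul0mx, mulmx0) !addr0 col_mx0. Qed.

Let Pif : Pi *m fvec = 0.
Proof. by rewrite fvecE mul_block_col Rr1 !(mul0mx, mulmx0) !addr0 col_mx0. Qed.

(** The coordinate projection onto the plane. *)
Let P := evec *m evec^T + fvec *m fvec^T.

Let PitPi : Pi^T *m Pi = 1%:M - P.
Proof.
apply/eqP; rewrite eq_sym subr_eq; apply/eqP.
rewrite /Pi tr_block_mx mulmx_block !trmx0 !(mul0mx, mulmx0) !addr0 !add0r.
rewrite /P evecE fvecE !tr_col_mx !mul_col_row !trmx0 !(mul0mx, mulmx0) !trmxK.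
by rewrite !add_block_mx !addr0 !add0r RtR -scalar_mx_block.
Qed.

Let ete : evec^T *m evec = 1%:M.
Proof. by rewrite evecE tr_col_mx mul_row_col trmxK r1r1 mulmx0 addr0. Qed.

Let ftf : fvec^T *m fvec = 1%:M.
Proof. by rewrite fvecE tr_col_mx mul_row_col trmxK r1r1 mulmx0 add0r. Qed.

Let etf : evec^T *m fvec = 0.
Proof. by rewrite evecE fvecE tr_col_mx mul_row_col trmx0 mul0mx mulmx0 addr0. Qed.

Let fte : fvec^T *m evec = 0.
Proof. by rewrite evecE fvecE tr_col_mx mul_row_col trmx0 mul0mx mulmx0 addr0. Qed.

(** Delta is the orthogonal sum of the form of size 2m and the hyperbolic plane. *)
Let DeltaPi :
  Pi^T *m Delta p m *m Pi = Delta p n - (evec *m fvec^T - fvec *m evec^T).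
Proof.
apply/eqP; rewrite eq_sym subr_eq; apply/eqP.
rewrite /Pi tr_block_mx /Delta !mulmx_block !trmx0 !(mul0mx, mulmx0).
rewrite evecE fvecE !tr_col_mx !mul_col_row !trmx0 !(mul0mx, mulmx0) !trmxK.
rewrite !addr0 !add0r.
rewrite opp_block_mx !add_block_mx !(mulmx1, mulmxN, mulNmx) !oppr0.
rewrite !(mul0mx, mulmx0) !addr0 !add0r RtR.
by rewrite -opprD RtR.
Qed.

Let Df : Delta p n *m fvec = evec.
Proof. by rewrite evecE fvecE mul_block_col !mul0mx !mulmx0 !addr0 add0r mul1mx. Qed.

Let De : Delta p n *m evec = - fvec.
Proof.
rewrite evecE fvecE mul_block_col !mul0mx !mulmx0 !addr0 mulNmx mul1mx.
by rewrite opp_col_mx oppr0.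
Qed.

(** Since Delta f = e, evaluating M^T Delta M = l Delta at f turns M f = f into M^T e = l e, and
    back because M^T Delta is invertible. *)
Lemma similitude_fix_fvec l M : l != 0 -> similitude l M ->
  (M *m fvec == fvec) = (evec^T *m M == l *: evec^T).
Proof.
move=> l0 Ml; have uM := similitude_unit l0 Ml; move/eqP: Ml => Ml.
rewrite -[RHS](inj_eq trmx_inj) trmx_mul !linearZ /= trmxK -Df.
apply/eqP/eqP => [{1}<-|]; first by rewrite !mulmxA Ml scalemxAl.
rewrite scalemxAl -Ml -!mulmxA => /(can_inj (mulKmx _)) -/(_ _) DMf.
apply: (can_inj (mulKmx (Delta_unit p n))); apply/esym/DMf.
by rewrite unitmx_tr.
Qed.

Let Sp_fix_ef := [set M in Sp_fix | M *m evec == evec].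

(** Invariance of the form turns M e = e and M f = f into conditions on rows, so [M] also preserves
    the complement of the plane. *)
Let Sp_fix_efP M : M \in Sp_fix_ef ->
  [/\ M \in Sp p n, evec^T *m M = evec^T, fvec^T *m M = fvec^T,
      M *m evec = evec & M *m fvec = fvec].
Proof.
case/setIdP=> /setIdP[SM Mf] /eqP Me; split=> //; last exact/eqP; move: (SM).
  rewrite mem_Sp => SM1; move: Mf; rewrite (similitude_fix_fvec _ SM1) ?oner_eq0 //.
  by rewrite scale1r => /eqP.
rewrite mem_Sp => /eqP; rewrite scale1r => /(congr1 (mulmx^~ evec)) /=.
rewrite -mulmxA Me -mulmxA De !mulmxN => /oppr_inj /(congr1 trmx).
by rewrite trmx_mul trmxK.
Qed.

(** [r] restricts to the complement and [E] extends by the identity on the plane; they are inverse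
    to each other. *)
Lemma card_Sp_fix_ef_Sp : #|Sp_fix_ef| = #|Sp p m|.
Proof.
pose r M := Pi *m M *m Pi^T; pose E N := Pi^T *m N *m Pi + P.
have tPe : evec^T *m Pi^T = 0 by rewrite -trmx_mul Pie trmx0.
have tPf : fvec^T *m Pi^T = 0 by rewrite -trmx_mul Pif trmx0.
have rE N : r (E N) = N.
  rewrite /r /E /P !(mulmxDl, mulmxDr) !mulmxA Pie Pif !mul0mx !addr0.
  by rewrite PiPit mul1mx -mulmxA PiPit mulmx1.
have Er : {in Sp_fix_ef, cancel r E}.
  move=> M /Sp_fix_efP[_ eM fM Me Mf].
  rewrite /r /E !mulmxA PitPi -[X in X + _]mulmxA PitPi.
  (* From M P = P M = P follows (1 - P) M (1 - P) + P = M. *)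
  have MP : M *m P = P by rewrite mulmxDr !mulmxA Me Mf.
  have PM : P *m M = P by rewrite mulmxDl -!mulmxA eM fM.
  have PP : P *m P = P.
    rewrite /P mulmxDl !mulmxDr !mulmxA -!(mulmxA _ _^T) ete etf fte ftf.
    by rewrite !mulmx1 !mulmx0 !mul0mx addr0 add0r.
  rewrite mulmxBl mul1mx PM mulmxBr !mulmxBl !mulmx1 MP PP subrr subr0.
  by rewrite subrK.
have EX N : N \in Sp p m -> E N \in Sp_fix_ef.
  move=> SN.
  have Ee : E N *m evec = evec.
    rewrite /E /P !mulmxDl -!mulmxA Pie ete fte !mulmx0 mulmx1 add0r addr0.
    by [].
  have Ef : E N *m fvec = fvec.
    rewrite /E /P !mulmxDl -!mulmxA Pif etf ftf !mulmx0 mulmx1 !add0r.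
    by [].
  apply/setIdP; rewrite Ee; split=> //; apply/setIdP; rewrite Ef; split=> //.
  have eE : evec^T *m E N = evec^T.
    by rewrite /E /P !mulmxDr !mulmxA tPe ete etf !mul0mx mul1mx add0r addr0.
  have fE : fvec^T *m E N = fvec^T.
    by rewrite /E /P !mulmxDr !mulmxA tPf ftf fte !mul0mx mul1mx !add0r.
  have PE : Pi *m E N = N *m Pi.
    by rewrite /E /P !mulmxDr !mulmxA Pie Pif !mul0mx !addr0 PiPit mul1mx.
  move: SN; rewrite !mem_Sp /similitude !scale1r => /eqP SN.
  have DE : Delta p n = Pi^T *m Delta p m *m Pi + (evec *m fvec^T - fvec *m evec^T).
    by rewrite DeltaPi subrK.
  have Ete : (E N)^T *m evec = evec by rewrite -[evec in LHS]trmxK -trmx_mul eE trmxK.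
  have Etf : (E N)^T *m fvec = fvec by rewrite -[fvec in LHS]trmxK -trmx_mul fE trmxK.
  have EPE : (E N)^T *m (Pi^T *m Delta p m *m Pi) *m E N = Pi^T *m Delta p m *m Pi.
    rewrite -[in RHS]SN !mulmxA -(trmx_mul Pi) PE trmx_mul -!mulmxA PE.
    by rewrite !mulmxA.
  rewrite DE mulmxDr mulmxDl EPE mulmxBr mulmxBl !mulmxA Ete Etf.
  by rewrite -2!(mulmxA _ _^T (E N)) eE fE.
have rX M : M \in Sp_fix_ef -> r M \in Sp p m.
  move=> /Sp_fix_efP[SM eM fM _ _].
  move: SM; rewrite !mem_Sp /similitude !scale1r => /eqP SM; apply/eqP.
  have Mte : M^T *m evec = evec by rewrite -[evec in LHS]trmxK -trmx_mul eM trmxK.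
  have Mtf : M^T *m fvec = fvec by rewrite -[fvec in LHS]trmxK -trmx_mul fM trmxK.
  rewrite /r !trmx_mul trmxK.
  have -> : Pi *m (M^T *m Pi^T) *m Delta p m *m (Pi *m M *m Pi^T)
    = Pi *m (M^T *m (Pi^T *m Delta p m *m Pi) *m M) *m Pi^T by rewrite !mulmxA.
  (* [X] is the part of Delta on the complement; [M] preserves it because it preserves Delta and the
     part on the plane. *)
  rewrite DeltaPi; set X := _ - (_ - _); have -> : M^T *m X *m M = X.
    rewrite /X mulmxBr mulmxBl SM mulmxBr mulmxBl !mulmxA Mte Mtf.
    by rewrite -2!(mulmxA _ _^T M) eM fM.
  by rewrite /X -DeltaPi !mulmxA PiPit mul1mx -mulmxA PiPit mulmx1.
have <- : r @: Sp_fix_ef = Sp p m.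
  apply/setP=> N; apply/imsetP/idP => [[M XM ->]|SN]; first exact: rX.
  by exists (E N); rewrite ?rE ?EX.
by rewrite card_in_imset //; apply: can_in_inj Er.
Qed.

Lemma card_Sp_fix : #|Sp_fix| = (p ^ (2 * n - 1) * #|Sp p m|)%N.
Proof. by rewrite card_Sp_fix_ef card_Sp_fix_ef_Sp. Qed.

Lemma card_SpS : #|Sp p n| = (p ^ (2 * n - 1) * (p ^ (2 * n) - 1) * #|Sp p m|)%N.
Proof. by rewrite card_Sp_fix_f card_Sp_fix mulnCA mulnA. Qed.

(** * Similitudes fixing f, and the order of the symplectic group *)

Definition stretch (l : F) : 'M[F]_(n + n) := block_mx l%:M 0 0 1%:M.

Lemma stretch_similitude l : similitude l (stretch l).
Proof.
rewrite /similitude /stretch /Delta tr_block_mx !mulmx_block !trmx0 trmx1.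
rewrite tr_scalar_mx !(mul0mx, mulmx0, addr0, add0r, mulmx1).
by rewrite mul1mx mulNmx mul1mx scale_block_mx scalerN !scaler0 !scalemx1.
Qed.

Lemma stretch_fvec l : stretch l *m fvec = fvec.
Proof. by rewrite fvecE mul_block_col !mul0mx !mulmx0 !add0r mul1mx. Qed.

(** Each such similitude is, in a unique way, [stretch l] times an element of [Sp_fix], with l its
    multiplier. *)
Lemma card_similitude_fix :
  #|[set M : 'M[F]_(n + n) |
    [exists l, [&& l != 0, similitude l M & M *m fvec == fvec]]]|
  = (p ^ (2 * n - 1) * (p - 1) * #|Sp p m|)%N.
Proof.
have D1 : Delta p n != 0.
  by apply: contraTneq (Delta_unit p n) => ->; rewrite unitmxE det0 unitr0.
pose h (x : F * 'M[F]_(n + n)) := stretch x.1 *m x.2.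
pose U : {set F} := ~: [set 0]; pose X := setX U Sp_fix.
have cU : #|U| = (p - 1)%N by rewrite cardsCs setCK cards1 card_Fp.
have simX x : x \in X -> [/\ x.1 != 0, similitude x.1 (h x) & h x *m fvec = fvec].
  case: x => l M; rewrite in_setX => /andP[/= l0 /setIdP[SM /eqP Mf]].
  rewrite !inE in l0; split=> //; last by rewrite -mulmxA Mf stretch_fvec.
  rewrite mem_Sp in SM.
  by have := similitudeM (stretch_similitude l) SM; rewrite mulr1.
have -> : [set M : 'M[F]_(n + n) |
    [exists l, [&& l != 0, similitude l M & M *m fvec == fvec]]] = h @: X.
  apply/setP=> M; rewrite inE; apply/existsP/imsetP => [[l /and3P[l0 Ml Mf]]|[x xX ->]].
    have ul := similitude_unit l0 (stretch_similitude l).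
    exists (l, invmx (stretch l) *m M); last by rewrite /h mulKVmx.
    rewrite in_setX in_setC in_set1 l0; apply/setIdP; split.
      rewrite mem_Sp -(mulVf l0) similitudeM ?similitudeV //.
      exact: stretch_similitude.
    by rewrite -mulmxA (eqP Mf) -{1}(stretch_fvec l) mulKmx.
  by have [l0 sl hf] := simX x xX; exists x.1; rewrite l0 sl hf eqxx.
rewrite card_in_imset => [|x y xX yX hxy].
  by rewrite cardsX card_Sp_fix cU mulnCA mulnA.
have [x0 /eqP sx _] := simX x xX; have [y0 /eqP sy _] := simX y yX.
(* The matrix determines its multiplier because Delta is nonzero. *)
have exy : x.1 = y.1.
  apply/eqP; rewrite -subr_eq0; move: sx; rewrite hxy sy => /esym/eqP.
  by rewrite -subr_eq0 -scalerBl scaler_eq0 (negPf D1) orbF.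
move: hxy; rewrite /h exy; have ul := similitude_unit y0 (stretch_similitude y.1).
move/(can_inj (mulKmx ul)) => e2.
by rewrite [x]surjective_pairing exy e2 -surjective_pairing.
Qed.
End Fixf.

Lemma card_Sp k : #|Sp p k| = (p ^ (k ^ 2) * \prod_(1 <= j < k.+1) (p ^ (2 * j) - 1))%N.
Proof.
elim: k => [|k IH].
  rewrite big_geq // muln1; apply/eqP/cards1P; exists 0; apply/setP=> M.
  by rewrite mem_Sp inE; apply/eqP/eqP=> _; apply/matrixP=> -[].
rewrite card_SpS IH [in RHS]big_nat_recr //= mulnACA -expnD [X in (_ * X)%N]mulnC.
(* The exponents add up to k^2 + 2(k + 1) - 1 = (k + 1)^2. *)
congr (p ^ _ * _)%N.
by rewrite -[in RHS]addn1 sqrnD exp1n muln1 mulnS add2n subn1 /= addnC -addnA add1n.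
Qed.
End CardSp.

(** * Endomorphisms of ES_2(p, n) *)

(** The arguments of [dotp] are swapped so that a fixed vector yields a linear form, that is, an
    element of the dual space. *)
Definition dotpr (p k : nat) (w u : 'cV['F_p]_k) : 'F_p := dotp u w.

Lemma dotpr_is_linear p k (w : 'cV['F_p]_k) : linear_for *%R (dotpr w).
Proof.
move=> a u v; rewrite /dotpr dotpDl; congr (_ + _).
by rewrite /dotp mulr_sumr; apply: eq_bigr => i _; rewrite mxE mulrA.
Qed.

HB.instance Definition _ p k (w : 'cV['F_p]_k) :=
  GRing.isLinear.Build 'F_p 'cV['F_p]_k 'F_p *%R (dotpr w) (dotpr_is_linear w).

(** Scalars of a prime field act as natural multiples, so additive maps are linear. *)
Lemma Fp_additive_coord p (p_pr : prime p) k (phi : 'cV['F_p]_k -> 'F_p) :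
  {morph phi : v w / v + w} ->
  forall v, phi v = \sum_j v j 0 * phi (delta_mx j 0).
Proof.
move=> phiD v; have phi0 : phi 0 = 0 by apply: (addrI (phi 0)); rewrite -phiD !addr0.
have phiX w i : phi (w *+ i) = phi w *+ i.
  by elim: i => [|i IH]; rewrite ?mulr0n // !mulrS phiD IH.
rewrite {1}[v]matrix_sum_delta (big_morph phi phiD phi0).
apply: eq_bigr => j _; rewrite big_ord1.
by rewrite -[v j 0]Fp_natrK scaler_nat phiX mulr_natl.
Qed.

Section GroupES2.
Variables (p : nat) (p_pr : prime p) (m : nat).
Local Notation F := 'F_p.
Local Notation n := m.+1.
Local Notation V := 'cV[F]_(n + n).
Local Notation ES := (ES2 p_pr m).
Local Notation G := [set: ES].
Local Notation Z := ('Z(G))%g.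

Local Notation evec := (evec p m).
Local Notation fvec := (fvec p m).

(** * Commutators and p-th powers in G *)

Lemma red21M (x y : 'Z_(p ^ 2)) : red21 (x * y) = red21 x * red21 y.
Proof. by rewrite -[x]Zp2_natrK -[y]Zp2_natrK -natrM !red21_nat // natrM. Qed.

Lemma isotr_es_vec (g h : ES) :
  isotr (es_vec g) (es_vec h) = red21 (es_u1 g) * es_w1 h + dotp (es_u g) (es_w h).
Proof.
rewrite /isotr /es_vec col_mxKu col_mxKd !dotpE (@tr_col_mx _ 1 m).
rewrite (@mul_row_col _ 1 1 m) tr_scalar_mx [LHS]mxE.
by rewrite -scalar_mxM [X in X + _]mxE mulr1n.
Qed.

Lemma es_u1M (g h : ES) :
  es_u1 (g * h)%g = es_u1 g + es_u1 h + i21 (isotr (es_vec g) (es_vec h)).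
Proof. by rewrite isotr_es_vec mulrC i21D // -i21M // addrA. Qed.

Lemma es_vec_u1 (g : ES) : es_vec g (lshift n 0) 0 = red21 (es_u1 g).
Proof.
rewrite /es_vec (@col_mxEu _ n n); set c := col_mx _ _.
have -> : c 0 0 = c (lshift m 0) 0 by congr (c _ _); apply: val_inj.
by rewrite col_mxEu mxE mulr1n.
Qed.

Lemma es_ext (g h : ES) : es_u1 g = es_u1 h -> es_vec g = es_vec h -> g = h.
Proof.
case: g h => [x u b w] [x' u' b' w']; rewrite /es_vec /= => ->.
have E (c c' : F) (v v' : 'cV[F]_m) :
    col_mx c%:M v = col_mx c'%:M v' :> 'cV_(1 + m) -> c = c' /\ v = v'.
  case/eq_col_mx=> /matrixP/(_ 0 0) cc ->; split=> //.
  by move: cc; rewrite !mxE !mulr1n.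
by case/eq_col_mx => /E[_ ->] /E[-> ->].
Qed.

(** The first coordinate of [v] is discarded in favour of [x]; [es_mkK] asks that they agree mod
    p. *)
Definition es_mk (x : 'Z_(p ^ 2)) (v : V) : ES :=
  let g := es_lift p_pr v in ES2El p_pr x (es_u g) (es_w1 g) (es_w g).

Lemma es_mkK x (v : V) : red21 x = v (lshift n 0) 0 -> es_vec (es_mk x v) = v.
Proof.
move=> xv; have e : red21 (es_u1 (es_lift p_pr v)) = v (lshift n 0) 0.
  by rewrite -es_vec_u1 es_liftK.
by rewrite -[RHS](es_liftK p_pr v) /es_vec e -xv.
Qed.

(** The power z^a of the generator z = [zpow 1] of the centre. *)
Definition zpow (a : F) : ES := ES2El p_pr (i21 a) 0 0 0.

Lemma es_vec_zpow a : es_vec (zpow a) = 0.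
Proof. by apply/eqP; rewrite -es_vec_ker; apply/es_centerP; exists a. Qed.

Lemma es_u1Mzpow g a : es_u1 (g * zpow a)%g = es_u1 g + i21 a.
Proof.
by rewrite es_u1M es_vec_zpow /isotr linear0 dotp0r i210 // addr0.
Qed.

Lemma es_vecMzpow g a : es_vec (g * zpow a)%g = es_vec g.
Proof. by rewrite es_vecM es_vec_zpow addr0. Qed.

Lemma es_vecV (g : ES) : es_vec g^-1%g = - es_vec g.
Proof. by apply: (addIr (es_vec g)); rewrite addNr -es_vecM mulVg es_vec1. Qed.

(** Swapping the factors changes the cocycle by isotr(v, w) - isotr(w, v) = omega(v, w). *)
Lemma es_mulC (g h : ES) :
  (g * h = h * g * zpow (omega (es_vec g) (es_vec h)))%g.
Proof.
apply: es_ext; last by rewrite es_vecMzpow !es_vecM addrC.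
rewrite es_u1Mzpow !es_u1M [es_u1 g + _]addrC -[RHS]addrA -i21D // omegaE.
by rewrite [isotr (es_vec h) _ + _]addrC subrK.
Qed.

Lemma es_conj (g h : ES) : (g ^ h = g * zpow (omega (es_vec g) (es_vec h)))%g.
Proof. by rewrite conjgE (es_mulC g h) -mulgA mulKg. Qed.

(** The cocycle contributes isotr(j v, v) for each j < k, and these sum to C(k, 2) isotr(v, v). *)
Lemma es_u1X (g : ES) k :
  es_u1 (g ^+ k)%g = es_u1 g *+ k + i21 (isotr (es_vec g) (es_vec g) *+ 'C(k, 2)).
Proof.
elim: k => [|k IH]; first by rewrite expg0 !mulr0n i210 // addr0.
rewrite expgSr es_u1M IH es_vecX binS bin1 mulrnDr i21D //.
have isoX v w j : isotr (v *+ j) w = isotr v w *+ j :> F.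
  elim: j => [|j IHj]; first by rewrite !mulr0n /isotr linear0 dotp0l.
  by rewrite !mulrSr isotrDl IHj.
by rewrite isoX mulrSr -!addrA; congr (_ + _); rewrite addrCA.
Qed.

(** For odd p the binomial C(p, 2) is divisible by p, so only p u_1 survives. *)
Lemma es_expp (p_odd : odd p) (g : ES) : (g ^+ p)%g = zpow (es_vec g (lshift n 0) 0).
Proof.
have pF (a : F) : a *+ p = 0 by rewrite -mulr_natr [p%:R]pchar_Fp_0 ?mulr0.
apply: es_ext; last first.
  rewrite es_vecX es_vec_zpow; apply/colP=> i; rewrite -scaler_nat !mxE.
  by rewrite [p%:R]pchar_Fp_0 // mul0r.
rewrite es_u1X bin2odd // mulrnA pF mul0rn i210 // addr0 es_vec_u1 /=.
rewrite -[es_u1 g]Zp2_natrK red21_nat // i21_nat // mulnC natrM mulr_natr.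
by [].
Qed.

Lemma zpow_inj : injective zpow.
Proof. by move=> a b [] /(i21_inj p_pr). Qed.

Lemma zpowC g a : (g * zpow a = zpow a * g)%g.
Proof.
apply: es_ext; last by rewrite !es_vecM addrC.
by rewrite es_u1Mzpow es_u1M es_vec_zpow /isotr linear0 dotp0l i210 // addr0 addrC.
Qed.

Lemma zpowD a b : (zpow a * zpow b)%g = zpow (a + b).
Proof.
by apply: es_ext; rewrite ?es_vecMzpow ?es_vec_zpow // es_u1Mzpow /= i21D.
Qed.

Lemma zpowX a k : (zpow a ^+ k)%g = zpow (a *+ k).
Proof.
elim: k => [|k IH]; last by rewrite expgSr IH zpowD mulrSr.
by rewrite expg0 mulr0n; apply: es_ext; rewrite ?es_vec_zpow ?es_vec1 //= i210.
Qed.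

Lemma es_vec_eq0_zpow (g : ES) : es_vec g = 0 -> exists a, g = zpow a.
Proof. exact: es_vec_eq0. Qed.

(** * Matrices of endomorphisms and automorphisms *)

Definition endo_mx (l : F) (M : 'M[F]_(n + n)) :=
  similitude l M && (evec^T *m M == l *: evec^T).

Lemma evec_mul (v : V) : (evec^T *m v) 0 0 = v (lshift n 0) 0.
Proof. by rewrite tr_delta_mul. Qed.

Lemma endo_mxP (p_odd : odd p) (f : ES -> ES) (M : 'M[F]_(n + n)) :
  {morph f : x y / (x * y)%g} -> (forall g, es_vec (f g) = M *m es_vec g) ->
  exists l, endo_mx l M /\ forall a, f (zpow a) = zpow (l * a).
Proof.
move=> fM fE; have f1 : f 1%g = 1%g by apply: (mulgI (f 1%g)); rewrite -fM !mulg1.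
have fX g k : f (g ^+ k)%g = (f g ^+ k)%g.
  by elim: k => [|k IH]; rewrite ?expg0 // !expgS fM IH.
(* The multiplier is read off the centre, which is the kernel of [es_vec]. *)
have [l fl] : exists l, f (zpow 1) = zpow l.
  by apply: es_vec_eq0_zpow; rewrite fE es_vec_zpow mulmx0.
have fz a : f (zpow a) = zpow (l * a).
  by rewrite -[a]Fp_natrK -[in LHS](zpowX 1) fX fl zpowX mulr_natr.
exists l; split=> //; apply/andP; split.
  apply/similitudeP=> v w; apply/zpow_inj; rewrite -fz.
  rewrite -[v](es_liftK p_pr) -[w](es_liftK p_pr) -!fE.
  set g := es_lift p_pr v; set h := es_lift p_pr w.
  (* Both sides complete f(h) f(g) to f(g) f(h): one by the commutator of the images, the other by
     [f] applied to that of g and h. *)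
  by apply: (mulgI (f h * f g)%g); rewrite -es_mulC -!fM -es_mulC.
(* The row condition results from applying [f] to the p-th powers of lifts of basis vectors. *)
apply/eqP/rowP=> j; set d : V := delta_mx j 0.
have dE (r : 'rV[F]_(n + n)) : r 0 j = (r *m d) 0 0 by rewrite -colE mxE.
rewrite !dE -scalemxAl [RHS]mxE -mulmxA !evec_mul; apply: zpow_inj.
by rewrite -fz -[d](es_liftK p_pr) -fE -!es_expp.
Qed.

Lemma endo_lift (p_odd : odd p) l (M : 'M[F]_(n + n)) : endo_mx l M ->
  exists f : ES -> ES, {morph f : x y / (x * y)%g} /\
    forall g, es_vec (f g) = M *m es_vec g.
Proof.
case/andP=> /similitudeP Ml /eqP eM.
have two : (2%:R : F) != 0.
  apply/eqP=> /(@Fp_eqP _ p_pr 2 0); rewrite mod0n modn_small //.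
  exact: odd_prime_gt2.
pose gam v w := isotr (M *m v) (M *m w) - l * isotr v w.
(* The antisymmetric part of [gam] vanishes by the similitude condition. *)
have gamC v w : gam v w = gam w v.
  have /eqP := Ml v w; rewrite -subr_eq0 !omegaE => /eqP e.
  by apply: subr0_eq; rewrite -[RHS]e /gam; ring.
have gamD v w : gam (v + w) (v + w) = gam v v + gam w w + 2%:R * gam v w.
  rewrite [2%:R * _]mulr_natl mulr2n {2}gamC /gam mulmxDr !isotrDl !isotrDr; ring.
(* With this factor 1/2, q(v + w) - q(v) - q(w) = gam(v, w), so [q] absorbs the defect of the
   cocycle. *)
pose q v := gam v v / 2%:R.
pose lt : 'Z_(p ^ 2) := (nat_of_ord l)%:R.
have redl : red21 lt = l by rewrite red21_nat // Fp_natrK.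
pose f (g : ES) : ES := es_mk (lt * es_u1 g + i21 (q (es_vec g))) (M *m es_vec g).
(* The row condition makes the first coordinate of M v the reduction mod p of [es_u1 (f g)]. *)
have fE g : es_vec (f g) = M *m es_vec g.
  apply: es_mkK; rewrite red21D // i21_red // addr0 red21M redl -es_vec_u1.
  by rewrite -[RHS]evec_mul mulmxA eM -scalemxAl [RHS]mxE evec_mul.
have fu g : es_u1 (f g) = lt * es_u1 g + i21 (q (es_vec g)) by [].
exists f; split=> [g h|]; last exact: fE.
apply: es_ext; last by rewrite fE !es_vecM !fE mulmxDr.
rewrite fu [in RHS]es_u1M 2!fE 2!fu es_u1M es_vecM.
set v := es_vec g; set w := es_vec h.
have -> : q (v + w) = q v + q w + gam v w.
  by rewrite /q gamD; field.
have -> : isotr (M *m v) (M *m w) = isotr v w * l + gam v w by rewrite /gam; ring.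
move: (gam v w) => k.
by rewrite !mulrDr [lt * i21 _]mulrC i21M // redl !i21D //; ring.
Qed.

Lemma quo_mx_morph (f : ES -> ES) (M : 'M[F]_(n + n)) :
  {morph f : x y / (x * y)%g} -> (forall g, es_vec (f g) = M *m es_vec g) ->
  quo_mx (quo_map f) = M.
Proof.
move=> fM fE; apply: quo_mx_uniq => x.
by rewrite -[x]es_coset_repr quo_mapE // !es_quo_vecE fE.
Qed.

Lemma Phi2_mxE (s : {perm ES}) : s \in Aut G ->
  quo_mx (Phi2 s) = quo_mx (quo_map s).
Proof. by move=> sA; apply/matrixP=> i j; rewrite !mxE Phi2E. Qed.

Lemma Phi2_mx_vec (s : {perm ES}) g : s \in Aut G ->
  es_vec (s g) = quo_mx (Phi2 s) *m es_vec g.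
Proof. by move=> sA; rewrite Phi2_mxE //; apply/quo_map_mxE/Aut_morph. Qed.

Lemma mem_im_End_mx (p_odd : odd p) M :
  (M \in im_End_mx p_pr m) = [exists l, endo_mx l M].
Proof.
apply/imsetP/existsP => [[f]|[l Ml]].
  rewrite inE => /morphicP fM ->.
  have {}fM : {morph f : x y / (x * y)%g} by move=> x y; rewrite fM ?inE.
  by have [l [Ml _]] := endo_mxP p_odd fM (quo_map_mxE fM); exists l.
have [f [fM fE]] := endo_lift p_odd Ml.
have ff : [ffun g => f g] =1 f by move=> g; rewrite ffunE.
exists [ffun g => f g]; first by rewrite inE; apply/morphicP=> x y _ _; rewrite !ff fM.
by rewrite (@quo_mx_morph _ M) // => [x y|g]; rewrite !ff ?fM ?fE.
Qed.

Lemma im_Phi2_mxP M :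
  reflect (exists2 s : {perm ES}, s \in Aut G & M = quo_mx (Phi2 s))
          (M \in im_Phi2_mx p_pr m).
Proof.
apply: (iffP imsetP) => [[_ /morphimP[s _ sA ->] ->]|[s sA ->]]; first by exists s.
by exists (Phi2 s) => //; apply: mem_morphim.
Qed.

(** If l = 0 the centre is killed. If l <> 0, then [M] is invertible and the lift is injective on
    the centre, hence bijective on the finite group G. *)
Lemma mem_im_Phi2_mx (p_odd : odd p) M :
  (M \in im_Phi2_mx p_pr m) = [exists l, (l != 0) && endo_mx l M].
Proof.
apply/im_Phi2_mxP/existsP => [[s sA ->]|[l /andP[l0 Ml]]].
  have [l [Ml sz]] := endo_mxP p_odd (Aut_morph sA) (fun g => Phi2_mx_vec g sA).
  exists l; rewrite Ml andbT; apply/eqP=> l0.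
  have /perm_inj/zpow_inj/eqP : s (zpow 1) = s (zpow 0) by rewrite !sz l0 !mul0r.
  by rewrite oner_eq0.
have [f [fM fE]] := endo_lift p_odd Ml.
have [k [/andP[_ /eqP Mk] fz]] := endo_mxP p_odd fM fE.
have fV g : f g^-1%g = (f g)^-1%g.
  apply: (mulgI (f g)); rewrite -fM !mulgV.
  by apply: (mulgI (f 1%g)); rewrite -fM !mulg1.
(* Both multipliers are the first entry of e^T M. *)
have lk : k = l.
  case/andP: Ml => _; rewrite Mk => /eqP/rowP/(_ (lshift n 0)).
  by rewrite !mxE !eqxx !mulr1.
have f_inj : injective f.
  move=> g h fgh; apply/eqP; rewrite eq_mulgV1.
  have : f (g * h^-1)%g = 1%g by rewrite fM fV fgh mulgV.
  move: (_ * _)%g => z fz1.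
  have uM : M \in unitmx by case/andP: Ml => /similitude_unit->.
  have /es_vec_eq0_zpow[a za] : es_vec z = 0.
    by rewrite -[es_vec z](mulKmx uM) -fE fz1 es_vec1 mulmx0.
  have z0 : zpow 0 = 1%g by apply: es_ext; rewrite ?es_vec_zpow ?es_vec1 //= i210.
  move: fz1; rewrite za fz lk -z0 => /zpow_inj/eqP; rewrite mulf_eq0 (negPf l0) /=.
  by move/eqP=> ->.
have sA : perm f_inj \in Aut G.
  rewrite inE; apply/andP; split; first by apply/subsetP=> x _; rewrite inE.
  by apply/morphicP=> x y _ _; rewrite !permE.
exists (perm f_inj) => //; rewrite Phi2_mxE //.
by rewrite (@quo_mx_morph _ M) // => [x y|g]; rewrite !permE.
Qed.

(** For l <> 0 the row condition amounts to fixing f, so the count of similitudes fixing f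
    applies. *)
Lemma card_im_Phi2 (p_odd : odd p) :
  #|im_Phi2 p_pr m| = (p ^ (2 * n - 1) * (p - 1) * #|Sp p m|)%N.
Proof.
rewrite -card_im_Phi2_mx -card_similitude_fix //; apply: eq_card => M.
rewrite mem_im_Phi2_mx // [RHS]inE; apply: eq_existsb => l.
have [//|l0] := eqVneq l 0; rewrite /endo_mx; case: (boolP (similitude l M)) => //= Ml.
by rewrite (similitude_fix_fvec l0 Ml).
Qed.

(** * Inner automorphisms *)

Lemma es_normG (h : ES) : h \in ('N(G))%g.
Proof. exact: subsetP (normG [set: ES]%G) h (in_setT h). Qed.

Lemma conj_autE (h g : ES) :
  conj_aut G h g = (g * zpow (omega (es_vec g) (es_vec h)))%g.
Proof. by rewrite -es_conj norm_conj_autE ?es_normG ?in_setT. Qed.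

Lemma Inn_ES2P (s : {perm ES}) :
  reflect (exists h, s = conj_aut G h) (s \in Inn_ES2 p_pr m).
Proof.
apply: (iffP idP) => [/morphimP[h _ _ ->]|[h ->]]; first by exists h.
by apply: mem_morphim; rewrite ?in_setT ?es_normG.
Qed.

Lemma Inn_ES2_Aut (s : {perm ES}) : s \in Inn_ES2 p_pr m -> s \in Aut G.
Proof. by case/Inn_ES2P=> h ->; apply: Aut_aut. Qed.

(** An automorphism trivial modulo the centre multiplies g by z^(lam(v)) with [lam] additive; as
    omega is nondegenerate, this is a conjugation. *)
Lemma Inn_ES2_Phi2 (p_odd : odd p) (s : {perm ES}) : s \in Aut G ->
  (s \in Inn_ES2 p_pr m) = (quo_mx (Phi2 s) == 1%:M).
Proof.
move=> sA; apply/Inn_ES2P/eqP => [[h sh]|s1].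
  rewrite Phi2_mxE //; apply: quo_mx_morph; first exact: Aut_morph.
  by move=> g; rewrite sh conj_autE es_vecMzpow mul1mx.
have sE g : es_vec (s g) = 1%:M *m es_vec g by rewrite -s1 Phi2_mx_vec.
have [l [/andP[_ /eqP l1] sz]] := endo_mxP p_odd (Aut_morph sA) sE.
have {l1 sz} sz a : s (zpow a) = zpow a.
  suff l1' : l = 1 by rewrite sz l1' mul1r.
  move/rowP: l1 => /(_ (lshift n 0)).
  by rewrite mulmx1 !mxE !eqxx mulr1.
have sM := Aut_morph sA.
(* The default 0 is never taken: the lift and its image have the same vector, so they differ by a
   power of z. *)
pose lam v := odflt 0 [pick a | s (es_lift p_pr v) == es_lift p_pr v * zpow a]%g.
have vec_eq (g h : ES) : es_vec g = es_vec h -> exists a, h = (g * zpow a)%g.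
  move=> gh; have [|a ga] := es_vec_eq0_zpow (g := (g^-1 * h)%g).
    by rewrite es_vecM es_vecV gh addNr.
  by exists a; rewrite -ga mulKVg.
have lamE g : s g = (g * zpow (lam (es_vec g)))%g.
  move gv : (es_vec g) => v; set h := es_lift p_pr v.
  have sh : s h = (h * zpow (lam v))%g.
    rewrite /lam; case: pickP => [a /eqP //|na].
    have [|a ha] := vec_eq h (s h); first by rewrite sE mul1mx.
    by have := na a; rewrite -/h -ha eqxx.
  have [|a ->] := vec_eq h g; first by rewrite es_liftK.
  by rewrite sM sz sh -!mulgA; congr (_ * _)%g; apply: zpowC.
have lamD : {morph lam : v w / v + w}.
  move=> v w; apply: zpow_inj.
  rewrite -[v](es_liftK p_pr) -[w](es_liftK p_pr).
  set g := es_lift _ v; set h := es_lift _ w.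
  apply: (mulgI (g * h)%g); rewrite -es_vecM -lamE sM !lamE -zpowD.
  by rewrite -!mulgA; congr (_ * _)%g; rewrite !mulgA; congr (_ * _)%g; rewrite zpowC.
(* Then lam(v) = v^T c, and v^T Delta h = v^T c is solved by h = Delta^(-1) c. *)
pose c : V := \col_j lam (delta_mx j 0).
exists (es_lift p_pr (invmx (Delta p n) *m c)); apply/permP=> g.
rewrite conj_autE lamE es_liftK; congr (_ * zpow _)%g.
rewrite (Fp_additive_coord p_pr lamD) /omega mulmxA -(mulmxA (_^T)).
rewrite mulmxV ?Delta_unit // mulmx1 !mxE; apply: eq_bigr => j _.
by rewrite !mxE.
Qed.

(** * The row and column conditions in block entries *)

Lemma row_evecP l (M : 'M[F]_(n + n)) :
  reflect [/\ ulsubmx M 0 0 = l, forall j, j != 0 -> ulsubmx M 0 j = 0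
             & forall j, ursubmx M 0 j = 0]
          (evec^T *m M == l *: evec^T).
Proof.
apply: (iffP eqP) => [/rowP eM|[M0 Ml Mr]].
  split=> [|j j0|j]; rewrite !mxE.
  - by have := eM (lshift n 0); rewrite tr_delta_mul !mxE !eqxx mulr1.
  - have := eM (lshift n j); rewrite tr_delta_mul !mxE eqxx andbT.
    by rewrite (inj_eq (@lshift_inj _ _)) (negPf j0) mulr0.
  - by have := eM (rshift n j); rewrite tr_delta_mul !mxE eq_rlshift mulr0.
apply/rowP=> i; rewrite tr_delta_mul !mxE eqxx andbT -[i]splitK.
case: (split i) => j /=; last first.
  by have := Mr j; rewrite !mxE mulr0.
rewrite (inj_eq (@lshift_inj _ _)); have [->|j0] := eqVneq j 0.
  by rewrite -M0 !mxE mulr1.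
by have := Ml j j0; rewrite !mxE mulr0.
Qed.

Lemma col_fvecP (M : 'M[F]_(n + n)) :
  reflect [/\ forall i, ursubmx M i 0 = 0, drsubmx M 0 0 = 1
             & forall i, i != 0 -> drsubmx M i 0 = 0]
          (M *m fvec == fvec).
Proof.
rewrite -colE; apply: (iffP eqP) => [/colP Mf|[Mu M1 Md]].
  split=> [i||i i0]; rewrite !mxE.
  - by have := Mf (lshift n i); rewrite !mxE eq_lrshift.
  - by have := Mf (rshift n 0); rewrite !mxE !eqxx.
  - have := Mf (rshift n i); rewrite !mxE eqxx andbT.
    by rewrite (inj_eq (@rshift_inj _ _)) (negPf i0).
apply/colP=> i; rewrite !mxE eqxx andbT -[i]splitK.
case: (split i) => j /=.
  by have := Mu j; rewrite !mxE eq_lrshift.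
rewrite (inj_eq (@rshift_inj _ _)); have [->|j0] := eqVneq j 0.
  by have := M1; rewrite !mxE.
by have := Md j j0; rewrite !mxE.
Qed.

(** * Explicit form of conjugations *)

Lemma zpow_ES2El x u b w a : (ES2El p_pr x u b w * zpow a)%g = ES2El p_pr (x + i21 a) u b w.
Proof.
by apply: es_ext; rewrite ?es_vecMzpow ?es_u1Mzpow // /es_vec /= red21D // i21_red // addr0.
Qed.

(** If the vectors differ, nondegeneracy of omega gives a v on which the two conjugations differ. *)
Lemma conj_aut_es_vec (g h : ES) :
  (conj_aut G g == conj_aut G h) = (es_vec g == es_vec h).
Proof.
apply/eqP/eqP => [gh|gh]; last by apply/permP=> x; rewrite !conj_autE gh.
apply/eqP; rewrite -subr_eq0; apply: contraT => /omega_nondeg[v].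
rewrite omegaC oppr_eq0 omegaDr -scaleN1r omegaZr mulN1r subr_eq0 => /eqP[].
apply: zpow_inj; apply: (mulgI (es_lift p_pr v)).
by rewrite -[v in omega v](es_liftK p_pr) -!conj_autE gh.
Qed.

Lemma dotpC k (u w : 'cV[F]_k) : dotp u w = dotp w u.
Proof. by apply: eq_bigr => i _; rewrite mulrC. Qed.

Lemma Inn_ES2_formula (s : {perm ES}) : s \in Inn_ES2 p_pr m ->
  exists (a : 'Z_(p ^ 2)) (alpha : {scalar 'cV[F]_m}) (beta : {scalar 'cV[F]_(1 + m)}),
    [/\ a \is a GRing.unit, nat_of_ord a = 1%N %[mod p]
      & forall u1 u w1 w, s (ES2El p_pr u1 u w1 w) =
          ES2El p_pr (a * u1 + i21 (alpha u + beta (col_mx w1%:M w))) u w1 w].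
Proof.
(* Conjugation by h adds i21(omega(es_vec g, es_vec h)) to u_1. The term u_1 w_1(h) goes into [a],
   the pairing of u with w(h) is alpha, and the rest is beta. *)
case/Inn_ES2P=> h ->; pose a : 'Z_(p ^ 2) := 1 + i21 (es_w1 h).
exists a, (dotpr (es_w h)), (dotpr (- usubmx (es_vec h) : 'cV_(1 + m))); split.
(* The inverse is 1 - x for x = i21(w_1(h)), because x^2 = 0. *)
- apply/unitrPr; exists (1 - i21 (es_w1 h)).
  by rewrite mulrC -subr_sqr expr1n expr2 i21M // i21_red // mulr0 i210 // subr0.
- apply: (Fp_eqP p_pr); rewrite -[LHS]/(red21 a) red21D // i21_red // addr0.
  by rewrite -[1]/(1%:R) red21_nat.
move=> u1 u w1 w; rewrite conj_autE zpow_ES2El; congr ES2El.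
have -> : a * u1 = u1 + i21 (red21 u1 * es_w1 h).
  by rewrite mulrDl mul1r i21M // [es_w1 h * _]mulrC.
rewrite omegaE isotr_es_vec /= -[RHS]addrA -i21D // -addrA.
congr (_ + i21 (_ + (_ + _))).
by rewrite /dotpr dotpC dotpNl // /isotr col_mxKd.
Qed.

(** * The exact sequence and the order of Aut(G) *)

Definition conj_quo (x : coset_of Z) : {perm ES} := conj_aut G (repr x).

Lemma conj_quoE (g : ES) : conj_quo (coset Z g) = conj_aut G g.
Proof.
by apply/eqP; rewrite conj_aut_es_vec -[es_vec (repr _)]/(es_quo_vec _) es_quo_vecE.
Qed.

Lemma conj_quoM : {in (G / Z)%g &, {morph conj_quo : x y / (x * y)%g}}.
Proof.
move=> x y _ _; rewrite -[x]es_coset_repr -[y]es_coset_repr.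
by rewrite -morphM ?es_normZ //= !conj_quoE morphM ?es_normG.
Qed.

Definition conj_quo_morphism := Morphism conj_quoM.

Lemma conj_quo_injm : ('injm conj_quo_morphism)%g.
Proof.
apply/injmP=> x y _ _ /= /eqP; rewrite conj_aut_es_vec => /eqP.
exact: es_quo_vec_inj.
Qed.

Lemma mem_quoZ (x : coset_of Z) : x \in (G / Z)%g.
Proof. by rewrite -[x]es_coset_repr mem_quotient ?in_setT. Qed.

Lemma conj_quo_im : (conj_quo_morphism @* (G / Z))%g = Inn_ES2 p_pr m.
Proof.
apply/setP=> s; apply/morphimP/Inn_ES2P => [[x _ _ ->]|[h ->]].
  by exists (repr x).
by exists (coset Z h); rewrite ?mem_quoZ //= conj_quoE.
Qed.

Lemma Inn_ES2_ker (p_odd : odd p) : Inn_ES2 p_pr m = ('ker (@Phi2 p p_pr m))%g.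
Proof.
apply/setP=> s; apply/idP/idP => [sI|/morphpreP[sA]].
  have sA := Inn_ES2_Aut sI; apply/kerP => //; apply/permP=> x.
  apply: es_quo_vec_inj; rewrite (quo_mxE (Phi2_morph sA)).
  by move: sI; rewrite Inn_ES2_Phi2 // => /eqP->; rewrite mul1mx perm1.
move/set1P=> s1; rewrite Inn_ES2_Phi2 //; apply/eqP; apply: quo_mx_uniq => x.
by rewrite s1 perm1 mul1mx.
Qed.

(** Through [es_lift], conjugations are parametrised bijectively by F_p^(2n). *)
Lemma card_Inn_ES2 : #|Inn_ES2 p_pr m| = (p ^ (2 * n))%N.
Proof.
rewrite -(card_V p_pr m) -cardsT.
have inj : injective (fun v : V => conj_aut G (es_lift p_pr v)).
  by move=> v w /eqP; rewrite conj_aut_es_vec !es_liftK => /eqP.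
rewrite -(card_imset _ inj); apply: eq_card => s.
apply/Inn_ES2P/imsetP => [[h ->]|[v _ ->]]; last by exists (es_lift p_pr v).
by exists (es_vec h); rewrite ?in_setT //; apply/eqP; rewrite conj_aut_es_vec es_liftK.
Qed.

Lemma card_Aut_ES2 (p_odd : odd p) :
  #|Aut G| = (p ^ (2 * n) * #|im_Phi2 p_pr m|)%N.
Proof.
rewrite -card_Inn_ES2 Inn_ES2_ker // /im_Phi2 card_morphim setIid.
have kA : ('ker (@Phi2 p p_pr m) \subset Aut G)%g by apply: subsetIl.
exact/esym/(Lagrange (G := Aut_group G) (H := 'ker (@Phi2 p p_pr m))%G).
Qed.

End GroupES2.

Theorem proposition4p1 (p : nat) (p_pr : prime p) (p_odd : odd p) (m : nat) :
  let n := m.+1 in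
  im_Phi2_mx p_pr m =
    [set M : 'M['F_p]_(m.+1 + m.+1) |
      let A := ulsubmx M in let C := ursubmx M in let B := drsubmx M in
      [&& M \in Sp_scalar p m.+1,
          A ord0 ord0 != 0,
          B ord0 ord0 == 1,
          [forall j, (j != ord0) ==> (A ord0 j == 0)],
          [forall j, C ord0 j == 0],
          [forall i, (i != ord0) ==> (C i ord0 == 0)],
          [forall i, (i != ord0) ==> (B i ord0 == 0)]
        & M^T *m Delta p m.+1 *m M == A ord0 ord0 *: Delta p m.+1]]
  /\
  (let T := [set M : 'M['F_p]_(m.+1 + m.+1) |
      let A := ulsubmx M in let C := ursubmx M in
      [&& M \in symp_scalar p m.+1,
          [forall j, A ord0 j == 0],
          [forall j, C ord0 j == 0]
        & M^T *m Delta p m.+1 *m M == 0]] in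
   im_End_mx p_pr m = im_Phi2_mx p_pr m :|: T /\
   [disjoint im_Phi2_mx p_pr m & T])
  /\
  (forall s : {perm ES2 p_pr m}, s \in Aut [set: ES2 p_pr m] ->
    (s \in Inn_ES2 p_pr m <-> quo_mx (Phi2 s) = 1%:M) /\
    (s \in Inn_ES2 p_pr m ->
      exists (a : 'Z_(p ^ 2)) (alpha : {scalar 'cV['F_p]_m})
             (beta : {scalar 'cV['F_p]_(1 + m)}),
        [/\ a \is a GRing.unit,
            nat_of_ord a = 1%N %[mod p]
          & forall (u1 : 'Z_(p ^ 2)) (u : 'cV['F_p]_m)
                   (w1 : 'F_p) (w : 'cV['F_p]_m),
              s (ES2El p_pr u1 u w1 w) =
              ES2El p_pr
                (a * u1 + i21 (alpha u + beta (col_mx w1%:M w))) u w1 w]))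
  /\
  (* exact sequence: c is induced by conjugation *)
  (exists c : {morphism ([set: ES2 p_pr m] / 'Z([set: ES2 p_pr m]))%g
                        >-> {perm ES2 p_pr m}},
    (forall g : ES2 p_pr m,
       c (coset 'Z([set: ES2 p_pr m])%g g) = conj_aut [set: ES2 p_pr m] g) /\
    [/\ 'injm c,
        c @* ([set: ES2 p_pr m] / 'Z([set: ES2 p_pr m]))%g = Inn_ES2 p_pr m,
        Inn_ES2 p_pr m \subset Aut [set: ES2 p_pr m],
        Inn_ES2 p_pr m = 'ker (@Phi2 p p_pr m)
      & @Phi2 p p_pr m @* Aut [set: ES2 p_pr m] = im_Phi2 p_pr m])
  /\
  #|im_Phi2 p_pr m| = (p ^ (2 * n - 1) * (p - 1) * #|Sp p (n - 1)|)%N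
  /\
  (#|Aut [set: ES2 p_pr m]| = (p ^ (2 * n) * #|im_Phi2 p_pr m|)%N /\
   #|Aut [set: ES2 p_pr m]| =
     (p ^ (n ^ 2 + 2 * n) * (p - 1) * \prod_(1 <= j < n) (p ^ (2 * j) - 1))%N).
Proof.
move=> n; split.
  apply/setP=> M; rewrite mem_im_Phi2_mx // inE.
  apply/existsP/and5P => [[l /and3P[l0 Ml eM]]|].
    (* Fixing f gives the first columns of C and B; the row condition gives the first rows of A and
       C. *)
    have := eM; rewrite -(similitude_fix_fvec l0 Ml) => /col_fvecP[C0 B1 Bc].
    have /row_evecP[A0 Al Cr] := eM.
    split; rewrite ?A0 ?B1 //.
    - rewrite inE (similitude_unit l0 Ml); apply/existsP; exists l.
      by rewrite l0.
    - by apply/forallP=> j; apply/implyP=> /Al->.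
    - apply/and4P; split=> //.
      + by apply/forallP=> j; rewrite Cr.
      + by apply/forallP=> i; rewrite C0 eqxx implybT.
      + by apply/forallP=> i; apply/implyP=> /Bc->.
  case=> _ A0 _ /forallP Al /and4P[/forallP Cr _ _ Ml].
  exists (ulsubmx M ord0 ord0); rewrite A0 /endo_mx /similitude Ml.
  apply/row_evecP; split=> // j.
    by move=> j0; apply/eqP; have /implyP := Al j; apply.
  exact/eqP/Cr.
split.
  split.
    apply/setP=> M; rewrite mem_im_End_mx // in_setU mem_im_Phi2_mx // inE.
    apply/existsP/orP => [[l Ml]|[/existsP[l /andP[_ Ml]]|]]; last first.
    (* The second set consists of the endomorphism matrices with l = 0. *)
    - case/and4P=> _ /forallP Al /forallP Cr /eqP Ml; exists 0.
      rewrite /endo_mx /similitude Ml scale0r eqxx; apply/row_evecP.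
      by split=> [|j _|j]; apply/eqP; [exact: Al | exact: Al | exact: Cr].
    - by exists l.
    have [l0|l0] := eqVneq l 0; last by left; apply/existsP; exists l; rewrite l0.
    right; move: Ml; rewrite l0 => /andP[Ml /row_evecP[A0 Al Cr]].
    apply/and4P; split; last by rewrite /similitude scale0r in Ml.
    - by rewrite inE; apply/existsP; exists 0.
    - by apply/forallP=> j; have [->|/Al->] := eqVneq j 0; rewrite ?A0.
    - by apply/forallP=> j; rewrite Cr.
  (* On the image of Aut(G) the entry a_11 is the nonzero l; in the second set it vanishes. *)
  apply/pred0P=> M /=; apply/negbTE/andP => -[]; rewrite mem_im_Phi2_mx //.
  case/existsP=> l /and3P[l0 _ /row_evecP[A0 _ _]].
  rewrite inE => /and4P[_ /forallP/(_ ord0)]; rewrite A0.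
  by rewrite (negPf l0).
split.
  move=> s sA; rewrite Inn_ES2_Phi2 //; split; first by split=> /eqP.
  by rewrite -Inn_ES2_Phi2 //; apply: Inn_ES2_formula.
split.
  exists (conj_quo_morphism p_pr m); split; first exact: conj_quoE.
  split=> //; [exact: conj_quo_injm | exact: conj_quo_im | | exact: Inn_ES2_ker].
  by apply/subsetP=> s; apply: Inn_ES2_Aut.
rewrite card_Aut_ES2 // card_im_Phi2 // (_ : (n - 1)%N = m) ?subn1 //; do 2!split=> //.
rewrite card_Sp // mulnACA mulnA [(p ^ _ * (p ^ _ * _))%N]mulnA !mulnA -!expnD.
(* With m = n - 1 the exponents add up to 2n + (2n - 1) + m^2 = n^2 + 2n. *)
congr (p ^ _ * _ * _)%N.
have -> : (2 * m.+1).-1 = (2 * m).+1 by rewrite mulnS add2n.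
by rewrite /n; ring.
Qed.
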